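(* Suppose that $A(\cdot):(a,b)\to\mathbb{R}^{n\times n}$ is a continuous matrix function on $(a,b)$. Then the following conditions are equivalent: (1) $A(s)\in\mathbb{Q}$ for all $s\in(a,b)$, and for any interval $[p,q]$ with $a<p<q<b$ there exists $t^*\in[p,q]$ such that $A(t^* )$ is irreducible; (2) the system $\dot\Phi(t)=A(t)\Phi(t)$ is a cyclic variation diminishing differential system (CVDDS) on $(a,b)$.
   Context: Here $\mathbb{Q}\subset\mathbb{R}^{n\times n}$ (not the rationals) denotes the set of $n\times n$ real matrices that are Metzler (every off-diagonal entry is nonnegative) and can have non-zero entries only on the main diagonal, the super-diagonal, the sub-diagonal, and in entries $(1,n)$ and $(n,1)$. A Metzler matrix is irreducible if its associated directed adjacency graph is strongly connected. Sign variations. For a vector $y\in\mathbb{R}^m$ with no zero entries, $\sigma(y)$ is the number of indices $k\in\{1,\dots,m-1\}$ with $y_ky_{k+1}<0$. For any $y\in\mathbb{R}^m$: $s^-(y):=\sigma(\bar y)$, where $\bar y$ is obtained from $y$ by deleting all zero entries (and $s^-(0):=0$); $s^+(y):=\max_{z\in P(y)}\sigma(z)$, where $P(y)$ is the set of vectors obtained from $y$ by replacing each zero entry by either $1$ or $-1$. Cyclic sign variations. For $y\in\mathbb{R}^n$, $$s_c^-(y):=\max_{i\in\{1,\dots,n\}} s^-\big([y_i,\dots,y_n,y_1,\dots,y_i]'\big),\qquad s_c^+(y):=\max_{i\in\{1,\dots,n\}} s^+\big([y_i,\dots,y_n,y_1,\dots,y_i]'\big),$$ where each bracketed vector has $n+1$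 entries (it goes once around the ring, beginning and ending with $y_i$), and where in the definition of $s_c^+$, if $y_i=0$, then both copies of $y_i$ (the first and the last entry) are replaced by the same value, either $1$ or $-1$. SCVDP. A matrix $B\in\mathbb{R}^{n\times n}$ satisfies the strong cyclic variation diminishing property (SCVDP) if $s_c^+(Bx)\le s_c^-(x)$ for all $x\in\mathbb{R}^n\setminus\{0\}$. CVDDS. Let $\Phi(t,t_0)$ denote the transition matrix, i.e. the solution of $\frac{d}{dt}\Phi(t,t_0)=A(t)\Phi(t,t_0)$, $\Phi(t_0,t_0)=I$. The system $\dot x(t)=A(t)x(t)$ (equivalently, $\dot\Phi(t)=A(t)\Phi(t)$) is called a cyclic variation diminishing differential system (CVDDS) on $(a,b)$ if $\Phi(t,t_0)$ satisfies the SCVDP for every pair $(t_0,t)$ with $a<t_0<t<b$. *)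

(* Defs.v *)
From HB Require Import structures.
From mathcomp Require Import all_boot all_order all_algebra.
From mathcomp Require Import all_classical all_reals all_analysis.
Import Order.TTheory GRing.Theory Num.Theory.
Import numFieldNormedType.Exports.

Set Implicit Arguments.
Unset Strict Implicit.
Unset Printing Implicit Defensive.

Local Open Scope classical_set_scope.
Local Open Scope ring_scope.

(* Vectors whose sign variations are counted are sequences of scalars; all    *)
(* indices are 0-based, so row/column 1 is index 0 and row/column n is n.-1.  *)

Section SignVariations.
Variable R : realDomainType.
Implicit Types (s : seq R) (e : seq bool).

(* Only meant for sequences without zero entries. *)
Definition sigma s : nat :=
  count (fun k => s`_k * s`_k.+1 < 0) (iota 0 (size s).-1).

Definition s_minus s : nat := sigma [seq u <- s | u != 0].

(* The set P(s) is {fill s e | e : (size s).-tuple bool}: the k-th sign of e  *)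
(* is used only if the k-th entry of s is zero.                               *)
Definition fill s e : seq R :=
  [seq if p.1 == 0 then (if p.2 then 1 else -1) else p.1 | p <- zip s e].

(* The n + 1 entries y_i, ..., y_n, y_1, ..., y_i. *)
Definition turn n (y : 'cV[R]_n) (i : 'I_n) : seq R :=
  [seq y j ord0 | j <- rcons (rot i (enum 'I_n)) i].

Definition sc_minus n (y : 'cV[R]_n) : nat :=
  \max_(i < n) s_minus (turn y i).

(* The condition on z only constrains e when y_i = 0; it then says that both  *)
(* copies of y_i receive the same sign.                                       *)
Definition sc_plus n (y : 'cV[R]_n) : nat :=
  \max_(i < n)
    \max_(e : (size (turn y i)).-tuple bool |
          let z := fill (turn y i) e in head 0%R z == last 0%R z)
      sigma (fill (turn y i) e).

Definition SCVDP n (B : 'M[R]_n) : Prop :=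
  forall x : 'cV[R]_n, x != 0 -> (sc_plus (B *m x) <= sc_minus x)%N.

End SignVariations.

Section MatrixClasses.
Variables (R : realDomainType) (n : nat).
Implicit Type M : 'M[R]_n.

Definition metzler M : Prop := forall i j, i != j -> 0 <= M i j.

(* The matrices of the class written as a blackboard-bold Q. *)
Definition cyclic_tridiagonal_metzler M : Prop :=
  metzler M /\
  forall i j : 'I_n, M i j != 0 ->
    [\/ i = j :> nat,
        j = i.+1 :> nat,
        i = j.+1 :> nat |
        (i = 0%N :> nat /\ j = n.-1 :> nat) \/
        (i = n.-1 :> nat /\ j = 0%N :> nat)].

(* [connect] is reflexive, so self-loops are irrelevant. *)
Definition irreducible_mx M : Prop :=
  forall i j : 'I_n, connect [rel k l : 'I_n | (k != l) && (M k l != 0)] i j.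

End MatrixClasses.

Section LinearSystem.
Variables (R : realType) (n : nat) (a b : \bar R).

Definition ooset : set R := [set t | (a < t%:E)%E /\ (t%:E < b)%E].

Definition is_transition_matrix (A : R -> 'M[R]_n) (Phi : R -> R -> 'M[R]_n) :=
  forall t0, ooset t0 ->
    Phi t0 t0 = 1%:M /\
    forall t, ooset t ->
      is_derive (t : R^o) 1 (fun s => Phi s t0) (A t *m Phi t t0).

(* For continuous A the transition matrix exists and is unique on the         *)
(* interval; its existence is part of this property, not a hypothesis.        *)
Definition CVDDS (A : R -> 'M[R]_n) : Prop :=
  exists Phi : R -> R -> 'M[R]_n,
    is_transition_matrix A Phi /\
    forall t0 t, ooset t0 -> ooset t -> t0 < t -> SCVDP (Phi t t0).

End LinearSystem.

(* Main.v *)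
Require Import Defs.
From HB Require Import structures.
From mathcomp Require Import all_boot all_order all_algebra.
From mathcomp Require Import zify ring lra.
From mathcomp Require Import all_classical all_reals all_analysis.
Import Order.TTheory GRing.Theory Num.Theory.
Import numFieldNormedType.Exports.

Set Implicit Arguments.
Unset Strict Implicit.
Unset Printing Implicit Defensive.

Local Open Scope classical_set_scope.
Local Open Scope ring_scope.

(** A cyclic sign count of [y] is a count of the changes of a function
    [f : 'I_n -> bool] of signs around the ring: [s_c^-] is the minimum and
    [s_c^+] the maximum of this count over all [f] that agree with the signs of
    the nonzero entries of [y].

    Sufficiency. To first order [1 + h A] is a product of positive scalings and
    of maps [x_i <- x_i + c x_j] with [c >= 0] and [j] next to [i], which do not
    increase [s_c^-]; since [s_c^- <= N] is a closed condition, the flow does not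
    increase [s_c^-].  Between [t0] and [t1] there is a subinterval on which each
    coordinate of [x] is identically zero or nowhere zero.  At a time [t] of it
    where [A] is irreducible, the equations of the vanishing coordinates force
    the two neighbours of each zero of [x t] to have opposite signs, so [s_c^-]
    is constant near [x t].  Perturb [x t1] so that its [s_c^-] becomes
    [s_c^+ (x t1)], and carry the perturbation back to time [t]: there [s_c^-] is
    at most [s_c^- (x t)], hence at most [s_c^- (x t0)].

    Necessity. The unit vectors have [s_c^-] equal to zero, so the entries of a
    column of the transition matrix have one strict sign; this gives the Metzler
    property, and, since reducibility on an interval yields a subinterval with a
    fixed reducible pattern and hence a zero entry, irreducibility.  An entry
    [(i, j)] outside the band would turn a vector with a single positive entry,
    at [j], into one with a second positive peak at [i]. *)

(** * Cyclic sign variations *)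

Local Notation next := (@ordS _).

Definition changes n (f : 'I_n -> bool) : nat :=
  \sum_(k < n) nat_of_bool (f k != f (next k)).

(** The value [true] stands for a positive sign; at a zero entry [f] is free, like the replacement
    values in $P(y)$. *)
Definition compat (R : realDomainType) n (y : 'cV[R]_n) (f : 'I_n -> bool) :=
  forall k, y k ord0 != 0 -> f k = (0 < y k ord0).

Definition bool_var (b : bool) (s : seq bool) : nat :=
  sumn (pairmap (fun x y : bool => nat_of_bool (x != y)) b s).

Section Combinatorics.
Variable R : realDomainType.
Implicit Types (u v : R) (s : seq R).

Lemma sigma_cons2 u v s : sigma (u :: v :: s) = ((u * v < 0)%R + sigma (v :: s))%N.
Proof.
rewrite /sigma /= -[1%N]addn0 iotaDl count_map; congr (_ + _)%N.
Qed.

Lemma mul_lt0_sign u v : u != 0 -> v != 0 -> (u * v < 0) = ((0 < u) != (0 < v)).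
Proof.
case: (ltrgt0P u) => // hu _; case: (ltrgt0P v) => // hv _ /=.
- by apply/negbTE; rewrite -leNgt ltW // mulr_gt0.
- by rewrite pmulr_rlt0.
- by rewrite nmulr_rlt0.
- by apply/negbTE; rewrite -leNgt ltW // nmulr_rgt0.
Qed.

Lemma sigma_bool_var u s : all (fun x => x != 0) (u :: s) ->
  sigma (u :: s) = bool_var (0 < u) [seq 0 < x | x <- s].
Proof.
elim: s u => [//|v s IH] u /= /and3P[hu hv hs].
rewrite sigma_cons2 /bool_var /= mul_lt0_sign //; congr (_ + _)%N.
by apply: IH; rewrite /= hv.
Qed.

Section CompatibleSigns.
Variables (n : nat) (y : 'cV[R]_n) (f : 'I_n -> bool).
Hypothesis hf : compat y f.
Let Y k := y k ord0.

(** The filled vector [z] has no zero entry, and its signs are exactly [f]. *)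
Lemma sigma_fill i (l : seq 'I_n) :
  sigma (fill (map Y (i :: l)) (map f (i :: l))) = bool_var (f i) (map f l).
Proof.
pose z k := if Y k == 0 then (if f k then 1 else -1) else Y k.
have fz k : (0 < z k) = f k.
  rewrite /z; case: eqP => [_|/eqP h]; last by rewrite hf.
  by case: (f k); rewrite ?ltr01 // oppr_gt0 ltr10.
have z0 k : z k != 0.
  rewrite /z; have [_|//] := eqVneq (Y k) 0.
  by case: (f k); rewrite ?oppr_eq0 oner_eq0.
have -> : forall l, fill (map Y l) (map f l) = map z l.
  by elim=> [//|k l' IH]; rewrite /fill /= -IH.
rewrite /= sigma_bool_var; last by rewrite /= z0; apply/allP => _ /mapP[k _ ->].
by rewrite fz -map_comp; congr bool_var; apply: eq_map => k /=.
Qed.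

Lemma s_minus_cons u s : u != 0 -> s_minus (u :: s) = sigma (u :: [seq v <- s | v != 0]).
Proof. by rewrite /s_minus /= => ->. Qed.

(** Here [u] is the last nonzero entry met. The first summand records whether [f] has departed from
    the sign of [u] on the zeros passed since; each further zero is absorbed by the triangle
    inequality. *)
Lemma s_minus_le_aux u k (l : seq 'I_n) : u != 0 ->
  (s_minus (u :: map Y l) <= (f k != (0 < u)%R) + bool_var (f k) (map f l))%N.
Proof.
elim: l u k => [|k' l IH] u k hu; first by rewrite s_minus_cons.
rewrite s_minus_cons //=; case: eqP => /= [_|/eqP hk].
  rewrite -s_minus_cons //; apply: leq_trans (IH u k' hu) _.
  rewrite /bool_var /=.
  rewrite addnA leq_add2r.
  by case: (f k); case: (f k'); case: (0 < u).
rewrite sigma_cons2 -s_minus_cons // mul_lt0_sign //.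
have := IH (Y k') k' hk; rewrite (hf hk) eqxx add0n => h.
rewrite /bool_var /=; apply: leq_trans (leq_add (leqnn _) h) _.
rewrite /Y /bool_var /= addnA leq_add2r.
by case: (f k); case: (0 < u); case: (0 < y _ _).
Qed.

Lemma s_minus_le i (l : seq 'I_n) :
  (s_minus (map Y (i :: l)) <= bool_var (f i) (map f l))%N.
Proof.
elim: l i => [|k l IH] i; first by rewrite /s_minus /=; case: ifP.
have [hi|hi] := eqVneq (Y i) 0; last first.
  by apply: leq_trans (s_minus_le_aux i (k :: l) hi) _; rewrite (hf hi) eqxx.
have -> : s_minus (map Y [:: i, k & l]) = s_minus (map Y (k :: l)).
  by rewrite /s_minus /= hi eqxx.
by apply: leq_trans (IH k) _; rewrite /bool_var /= leq_addl.
Qed.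

(** Equality holds when [f] carries each sign through the zeros that follow it: all its changes then
    occur at nonzero entries and survive the deletion of zeros. *)
Lemma s_minus_carry u k (l : seq 'I_n) : u != 0 -> f k = (0 < u) ->
  path (fun a b => (Y b != 0) || (f b == f a)) k l ->
  s_minus (u :: map Y l) = bool_var (f k) (map f l).
Proof.
elim: l u k => [|k' l IH] u k hu fk /=; first by rewrite s_minus_cons.
case/andP; rewrite s_minus_cons //=; case: eqP => /= [_|/eqP hk' _].
  move=> /eqP fk' hp; rewrite -s_minus_cons // (IH u k') ?fk' //.
  by rewrite /bool_var /= eqxx.
move=> hp; rewrite sigma_cons2 -s_minus_cons // (IH _ k' hk' (hf hk') hp).
by rewrite mul_lt0_sign // /bool_var /= fk !(hf hk').
Qed.

End CompatibleSigns.

Lemma bool_var_traject n (f : 'I_n -> bool) i m :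
  bool_var (f i) (map f (traject next (next i) m)) =
  (\sum_(k <- traject next i m) nat_of_bool (f k != f (next k)))%N.
Proof.
elim: m i => [|m IH] i; first by rewrite big_nil.
by rewrite trajectS big_cons -IH.
Qed.

Lemma iter_ordS n (i : 'I_n) m : iter m next i = ((i + m) %% n)%N :> nat.
Proof.
elim: m => [|m IH] /=; first by rewrite addn0 modn_small.
by rewrite IH -addn1 modnDml addn1 addnS.
Qed.

Lemma rot_enum_traject n (i : 'I_n) : rot i (enum 'I_n) = traject next i n.
Proof.
have szr : size (rot i (enum 'I_n)) = n by rewrite size_rot size_enum_ord.
apply: (@eq_from_nth _ i) => [|m]; rewrite szr ?size_traject // => hm.
apply: ord_inj => /=; rewrite nth_traject // iter_ordS.
rewrite /rot nth_cat size_drop size_enum_ord nth_drop.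
have hi := ltn_ord i.
case: ltnP => h; first by rewrite nth_enum_ord ?modn_small //; lia.
rewrite nth_take; last by lia.
rewrite nth_enum_ord; last by lia.
have -> : (i + m = (m - (n - i)) + n)%N by lia.
by rewrite modnDr modn_small //; lia.
Qed.

Lemma rcons_rot_enum n (i : 'I_n) :
  rcons (rot i (enum 'I_n)) i = i :: traject next (next i) n.
Proof.
rewrite rot_enum_traject -trajectS trajectSr; congr rcons.
by apply: ord_inj; rewrite iter_ordS modnDr modn_small.
Qed.

(** A full turn crosses each edge of the ring once, whatever its starting point. *)
Lemma bool_var_turn n (f : 'I_n -> bool) i :
  bool_var (f i) (map f (traject next (next i) n)) = changes f.
Proof.
rewrite bool_var_traject -rot_enum_traject.
by rewrite (perm_big _ (permEl (perm_rot _ _))) big_enum.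
Qed.

Lemma turnE n (y : 'cV[R]_n) i :
  turn y i = [seq y j ord0 | j <- i :: traject next (next i) n].
Proof. by rewrite /turn rcons_rot_enum. Qed.

Lemma sc_minus_le n (y : 'cV[R]_n) f : compat y f -> (sc_minus y <= changes f)%N.
Proof.
move=> hf; apply/bigmax_leqP => i _.
by rewrite turnE; apply: leq_trans (s_minus_le hf _ _) _; rewrite bool_var_turn.
Qed.

Lemma changes_cst n b : changes (fun _ : 'I_n => b) = 0%N.
Proof. by rewrite /changes big1 // => i _; rewrite eqxx. Qed.

(** [d k] is the number of steps from [i] to [k]; with it, sign functions can be defined along a
    turn that starts at [i]. *)
Lemma ordS_dist n (i : 'I_n) : exists d : 'I_n -> nat,
  (forall k, (d k < n)%N /\ iter (d k) next i = k) /\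
  (forall m, (m < n)%N -> d (iter m next i) = m).
Proof.
have h1 := ltn_ord i; exists (fun k : 'I_n => ((k + n - i) %% n)%N); split=> [k|m hm].
  split; first by rewrite ltn_mod; lia.
  apply: ord_inj; rewrite iter_ordS modnDmr.
  have h2 := ltn_ord k.
  by rewrite subnKC ?modnDr ?modn_small //; lia.
rewrite iter_ordS.
have [h|h] := ltnP (i + m) n.
  by rewrite (modn_small h) (_ : i + m + n - i = m + n)%N ?modnDr ?modn_small //; lia.
have -> : ((i + m) %% n = i + m - n)%N.
  by rewrite -{1}(subnK h) modnDr modn_small //; lia.
by rewrite (_ : i + m - n + n - i = m)%N ?modn_small //; lia.
Qed.

(** The turn starts at a nonzero entry [i], so that every zero has a nonzero entry before it whose
    sign it can copy. *)
Lemma sc_minus_attained n (y : 'cV[R]_n) :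
  exists2 f, compat y f & changes f = sc_minus y.
Proof.
have [/forallP h0|/forallPn[i hi]] := boolP [forall k, y k ord0 == 0].
  exists (fun=> true); first by move=> k; rewrite (eqP (h0 k)) eqxx.
  apply/eqP; rewrite changes_cst eq_sym -leqn0.
  rewrite -(@changes_cst n true) sc_minus_le // => k; by rewrite (eqP (h0 k)) eqxx.
suff [f hf hp] : exists2 f, compat y f &
    path (fun a b => (y b ord0 != 0) || (f b == f a)) i (traject next (next i) n).
  exists f => //; apply/eqP; rewrite eqn_leq sc_minus_le // andbT.
  rewrite -(bool_var_turn f i) -(s_minus_carry hf hi _ hp) ?(hf _ hi) //.
  apply: leq_trans (leq_bigmax i); rewrite turnE //.
(* [f k] is the sign of the last nonzero entry met when walking from [i] to [k] *)
pose w := fix w m := if m is m'.+1 then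
    let k := iter m next i in
    if y k ord0 == 0 then w m' else 0 < y k ord0
  else 0 < y i ord0.
have [d [itd dm]] := ordS_dist i.
pose f k := w (d k).
have wm m : y (iter m next i) ord0 != 0 -> w m = (0 < y (iter m next i) ord0).
  by case: m => [|m] //= /negbTE ->.
exists f; first by move=> k hk; have [_ e] := itd k; rewrite /f wm ?e.
apply/(pathP i) => m; rewrite size_traject => hm.
have -> : nth i (i :: traject next (next i) n) m = iter m next i.
  by rewrite -trajectS nth_traject // ltnS ltnW.
rewrite (set_nth_default (next i)) ?size_traject // nth_traject // -iterSr.
have [e|e] := eqVneq (y (iter m.+1 next i) ord0) 0 => //=.
(* The last step of the turn returns to [i], where [y] is nonzero; a zero at step [m.+1] is
   therefore met before the turn closes. *)
have hm' : (m.+1 < n)%N.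
  rewrite ltn_neqAle hm andbT; apply/eqP => E; move: hi; rewrite -e.
  suff -> : iter m.+1 next i = i by rewrite eqxx.
  by apply: ord_inj; rewrite iter_ordS E modnDr modn_small.
by rewrite /f -[next _]/(iter m.+1 next i) !dm //= -[next _]/(iter m.+1 next i) e eqxx.
Qed.

Lemma sc_plus_ge n (y : 'cV[R]_n) f : (0 < n)%N -> compat y f ->
  (changes f <= sc_plus y)%N.
Proof.
case: n y f => // n y f _ hf.
have sz : size (map f (ord0 :: traject next (next ord0) n.+1)) == size (turn y ord0).
  by rewrite turnE !size_map.
pose e := Tuple sz.
have fE l : fill l e = fill l (map f (ord0 :: traject next (next ord0) n.+1)) by [].
pose F k := if y k ord0 == 0 then if f k then 1 else -1 else y k ord0.
have F_E l : fill [seq y j ord0 | j <- l] [seq f j | j <- l] = map F l.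
  by rewrite /fill; elim: l => //= k l ->.
have last_t : last ord0 (traject next (next ord0) n.+1) = ord0 :> 'I_n.+1.
  rewrite trajectSr last_rcons.
  by apply: ord_inj; rewrite -iterSr iter_ordS add0n modnn.
have he : head 0 (fill (turn y ord0) e) == last 0 (fill (turn y ord0) e).
  rewrite fE turnE F_E; move: last_t; move: (traject _ _ n.+1) => t last_t.
  by rewrite /= last_map last_t.
apply: leq_trans (leq_bigmax ord0); apply: leq_trans (leq_bigmax_cond _ he).
by rewrite -(bool_var_turn f ord0) -(sigma_fill hf) fE turnE.
Qed.

(** Every admissible filling of a turn comes from a compatible [f]. If no [f] attained the maximum,
    all fillings would stay below it by at least one. *)
Lemma sc_plus_attained n (y : 'cV[R]_n) : (0 < n)%N ->
  exists2 f, compat y f & sc_plus y = changes f.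
Proof.
move=> hn; apply: contrapT => H.
have lt f : compat y f -> (changes f < sc_plus y)%N.
  move=> hf; rewrite ltn_neqAle sc_plus_ge // andbT; apply/eqP => E.
  by apply: H; exists f.
have [f0 /lt hf0 _] := sc_minus_attained y.
have sc0 : (0 < sc_plus y)%N by apply: leq_ltn_trans hf0.
suff : (sc_plus y <= (sc_plus y).-1)%N by lia.
apply/bigmax_leqP => i _; apply/bigmax_leqP => e /= he.
have sze : size (tval e) = n.+1 by rewrite size_tuple turnE size_map /= size_traject.
move: (tval e) sze he => {}e sze he; pose z := fill (turn y i) e.
have szz : size z = n.+1.
  by rewrite /z size_map size_zip sze turnE size_map /= size_traject minnn.
have zE m : (m <= n)%N -> let u := y (iter m next i) ord0 in
    z`_m != 0 /\ (u != 0 -> z`_m = u).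
  move=> hm /=; rewrite /z /fill (nth_map (0, true)); last first.
    by rewrite size_zip sze turnE size_map /= size_traject minnn.
  rewrite nth_zip; last by rewrite turnE sze size_map /= size_traject.
  rewrite turnE -trajectS (nth_map i) ?size_traject // nth_traject //=.
  case: (eqVneq (y _ _) 0) => // _; split => //.
  by case: ifP => _; rewrite ?oppr_eq0 oner_eq0.
have [d [itd dm]] := ordS_dist i.
have itn : iter n next i = i by apply: ord_inj; rewrite iter_ordS modnDr modn_small.
(* The turn meets [i] twice: [f i] is read at the first visit, and [he] makes the second visit
   agree. *)
pose f (k : 'I_n) := 0 < z`_(d k).
have hf : compat y f.
  move=> k hk; have [dk ek] := itd k.
  by have [_] := zE _ (ltnW dk); rewrite ek /f => ->.
rewrite -/z; suff -> : sigma z = changes f by have := lt f hf; lia.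
have zcons : z = z`_0 :: behead z by case: (z) szz.
rewrite zcons sigma_bool_var -?zcons; last first.
  by apply/(all_nthP 0) => m; rewrite szz ltnS => /zE[].
have d0 : d i = 0%N by apply: (dm 0%N).
rewrite -(bool_var_turn f i) (_ : f i = (0 < z`_0)) /f ?d0 //; congr bool_var.
apply: (@eq_from_nth _ true) => [|m].
  by rewrite !size_map size_behead szz size_traject.
rewrite size_map size_behead szz /= => hm.
rewrite (nth_map 0) ?size_behead ?szz // (nth_map (next i)) ?size_traject //.
rewrite nth_traject // -iterSr nth_behead.
have [hm'|] := ltnP m.+1 n; first by rewrite dm.
move=> hm'; have -> : m.+1 = n by apply/eqP; rewrite eqn_leq hm hm'.
by rewrite itn d0; move: he; rewrite -/z -nth0 -nth_last szz /= => /eqP ->.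
Qed.
End Combinatorics.

(** * Changing a single sign on the ring *)

Definition upd n (f : 'I_n -> bool) i b : 'I_n -> bool :=
  fun k => if k == i then b else f k.

Local Notation prev := (@ord_pred _).

Lemma next_prev_neq n (i : 'I_n) : prev i != i -> next i != i.
Proof. by apply: contraNneq => h; rewrite -{1}h ordSK. Qed.

(** Two distinct indices force $n\ge 2$; [prev i != i] is the form in which this is carried
    below. *)
Lemma prev_neq n (i j : 'I_n) : i != j -> prev i != i.
Proof.
move=> ij; apply/eqP => /(congr1 val) /=.
have := ltn_ord i; have := ltn_ord j; move: ij; rewrite -val_eqE /=.
case: (val i) => [|m] h1 h2 h3; last first.
  by rewrite addSn /= modnDr modn_small; lia.
by rewrite add0n modn_small; lia.
Qed.

(** Only the two edges at [i] see the sign of [i]. The balance is written additively to avoid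
    subtraction of naturals. *)
Lemma changes_upd n (f : 'I_n -> bool) i b : prev i != i ->
  (changes (upd f i b) + ((f (prev i) != f i) + (f i != f (next i))) =
   changes f + ((f (prev i) != b) + (b != f (next i))))%N.
Proof.
move=> hi; have hi' := next_prev_neq hi.
have E (g : 'I_n -> bool) : changes g = ((g (prev i) != g i) + (g i != g (next i)) +
    \sum_(k < n | (k != i) && (k != prev i)) nat_of_bool (g k != g (next k)))%N.
  rewrite /changes (bigD1 i) //= (bigD1 (prev i)) //= ord_predK.
  by rewrite addnCA addnA.
rewrite !E /upd eqxx (negbTE hi) (negbTE hi').
under eq_bigr => k /andP[k1 k2].
  have k3 : next k != i by apply: contra k2 => /eqP <-; rewrite ordSK.
  rewrite (negbTE k1) (negbTE k3); over.
by rewrite /= [LHS]addnC addnA addnAC.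
Qed.

Lemma changes_copy_next n (f : 'I_n -> bool) i : prev i != i ->
  (changes (upd f i (f (next i))) <= changes f)%N.
Proof.
move=> /(changes_upd f (f (next i))) h.
move: h; case: (f (prev i)); case: (f i); case: (f (next i)) => /=; lia.
Qed.

Lemma changes_copy_prev n (f : 'I_n -> bool) i : prev i != i ->
  (changes (upd f i (f (prev i))) <= changes f)%N.
Proof.
move=> /(changes_upd f (f (prev i))) h.
move: h; case: (f (prev i)); case: (f i); case: (f (next i)) => /=; lia.
Qed.

(** Between opposite signs exactly one of the two edges at [i] carries a change, whatever the sign
    at [i]. *)
Lemma changes_upd_between n (f : 'I_n -> bool) i b :
  f (prev i) != f (next i) -> changes (upd f i b) = changes f.
Proof.
move=> h; have hi : prev i != i.
  apply: contraNneq h => h; rewrite {1}h; apply/eqP; congr f.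
  by rewrite -{2}h ord_predK.
have := changes_upd f b hi.
by move: h; case: (f (prev i)); case: (f i); case: (f (next i)); case: b => //=; lia.
Qed.

Definition neighbours n (i j : 'I_n) := (j == next i) || (j == prev i).

Section VariationDiminishing.
Variables (R : realDomainType) (n : nat).
Implicit Types x y : 'cV[R]_n.

(* If the sign of the [i]-th entry changes, it becomes that of its neighbour. *)
Lemma sc_minus_add_neighbour x y i j c : 0 <= c -> j != i -> neighbours i j ->
    (forall k, y k ord0 = x k ord0 + (k == i)%:R * (c * x j ord0)) ->
  (sc_minus y <= sc_minus x)%N.
Proof.
move=> c0 ji adj yE; have [f hf <-] := sc_minus_attained x.
have pi := prev_neq ji; have pi' : prev i != i by rewrite (@prev_neq _ i j) // eq_sym.
have yk k : k != i -> y k ord0 = x k ord0.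
  by move=> /negbTE ki; rewrite yE ki mul0r addr0.
have yi : y i ord0 = x i ord0 + c * x j ord0 by rewrite yE eqxx mul1r.
have [yi0|yi0] := eqVneq (y i ord0) 0.
  apply: sc_minus_le => k hk; have ki : k != i by apply: contra_neq hk => ->.
  by move: hk; rewrite yk //; apply: hf.
have [e|ne] := eqVneq (f i) (0 < y i ord0).
  apply: sc_minus_le => k hk; have [->//|ki] := eqVneq k i.
  by move: hk; rewrite yk //; apply: hf.
(* As [f i] disagrees with the sign of [y i], the entry [x i] is zero or of the other sign; only
   [c * x j] can have given [y i] its sign. *)
have fj : f j = (0 < y i ord0).
  have [yp|yn] := ltP 0 (y i ord0).
    have xi : x i ord0 <= 0.
      rewrite leNgt; apply/negP => xp; move: ne.
      by rewrite (hf i (lt0r_neq0 xp)) xp yp eqxx.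
    have xj : 0 < x j ord0.
      rewrite ltNge; apply/negP => xj.
      have : y i ord0 <= 0 by rewrite yi -[leRHS]addr0 lerD // mulr_ge0_le0.
      by rewrite leNgt yp.
    by rewrite (hf j (lt0r_neq0 xj)) xj.
  have yn' : y i ord0 < 0 by rewrite lt_neqAle yi0.
  have xi : 0 <= x i ord0.
    rewrite leNgt; apply/negP => xp; move: ne.
    by rewrite (hf i (ltr0_neq0 xp)) [0 < x i _]ltNge (ltW xp) ltNge yn.
  have xj : x j ord0 < 0.
    rewrite ltNge; apply/negP => xj.
    have : 0 <= y i ord0 by rewrite yi addr_ge0 // mulr_ge0.
    by rewrite leNgt yn'.
  by rewrite (hf j (ltr0_neq0 xj)) ltNge ltW.
have hg : compat y (upd f i (f j)).
  move=> k hk; rewrite /upd; have [->//|ki] := eqVneq k i.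
  by move: hk; rewrite yk //; apply: hf.
apply: leq_trans (sc_minus_le hg) _.
by case/orP: adj => /eqP ->; rewrite ?changes_copy_next ?changes_copy_prev.
Qed.

(** Signs compatible with [y] are compatible with [x]. Together with [nonzero_gap] this is the lower
    semicontinuity of $s_c^-$. *)
Lemma sc_minus_same_signs x y : (forall k, x k ord0 != 0 -> 0 < x k ord0 * y k ord0) ->
  (sc_minus x <= sc_minus y)%N.
Proof.
move=> h; have [f hf <-] := sc_minus_attained y.
apply: sc_minus_le => k hk; have yk := h k hk.
have yk0 : y k ord0 != 0 by apply: contraTneq yk => ->; rewrite mulr0 ltxx.
rewrite hf //; move: yk; case: (ltrgt0P (x k ord0)) hk => // xk _.
  by rewrite pmulr_rgt0.
by rewrite nmulr_rgt0 // => yk; rewrite ltNge ltW.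
Qed.

(** The vector [s] holds the maximizing signs at the zeros of [x]; [x + e *: s] has no zero entry,
    so these signs are its only compatible ones. *)
Lemma sc_plus_perturb x : (0 < n)%N -> exists s : 'cV[R]_n,
  forall e, 0 < e -> (sc_plus x <= sc_minus (x + e *: s))%N.
Proof.
move=> hn; have [f hf ->] := sc_plus_attained x hn.
exists (\col_k if x k ord0 == 0 then if f k then 1 else -1 else 0) => e e0.
set s := \col_k _; have [g hg <-] := sc_minus_attained (x + e *: s); move: hg; rewrite /s => hg.
rewrite leq_eqVlt; apply/orP; left; apply/eqP; apply: eq_bigr => k _.
suff fg i : f i = g i by rewrite !fg.
have := hg i; rewrite !mxE; have [xi|xi] := eqVneq (x i ord0) 0; last first.
  by rewrite mulr0 addr0 => -> //; exact: hf.
rewrite xi add0r; case: (f i); first by rewrite mulr1 e0 => ->; rewrite ?gt_eqF.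
by rewrite mulrN1 oppr_gt0 ltNge (ltW e0) oppr_eq0 => ->; rewrite ?gt_eqF.
Qed.

(** The sign is crossed at each zero, so all sign functions compatible with [x] have the same
    count. *)
Definition regular x :=
  forall i, x i ord0 = 0 -> x (prev i) ord0 * x (next i) ord0 < 0.

(** Induction on the number of indices where [f] and [g] differ. At such an index [x] vanishes, so
    its neighbours have opposite signs and [f] can be corrected there without changing the count. *)
Lemma regular_changes x f g : regular x -> compat x f -> compat x g ->
  changes f = changes g.
Proof.
move=> rx hf hg.
have [m] := ubnP #|[pred k | f k != g k]|; elim: m f hf => // m IH f hf.
have [/forallP e _|/forallPn[i hi]] := boolP [forall k, f k == g k].
  by apply: eq_bigr => k _; rewrite !(eqP (e _)).
have xi : x i ord0 = 0.
  by apply/eqP; apply: contraR hi => h; rewrite hf ?hg.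
move=> hm.
have hu : compat x (upd f i (g i)).
  move=> k; rewrite /upd; have [->|_] := eqVneq k i; last exact: hf.
  by rewrite xi eqxx.
rewrite -(IH _ hu); last first.
  move: hm; rewrite ltnS; apply: leq_trans; apply: proper_card; apply/properP; split.
    apply/fintype.subsetP => k; rewrite !inE /upd; case: (eqVneq k i) => // ->.
    by rewrite eqxx.
  by exists i; rewrite inE /upd ?eqxx.
rewrite changes_upd_between //.
have := rx i xi; set a := x _ _; set b := x _ _ => ab.
have a0 : a != 0 by apply: contraTneq ab => ->; rewrite mul0r ltxx.
have b0 : b != 0 by apply: contraTneq ab => ->; rewrite mulr0 ltxx.
by rewrite (hf _ a0) (hf _ b0) -/a -/b -mul_lt0_sign.
Qed.

Lemma regular_sc_minus x y : regular x ->
  (forall k, x k ord0 != 0 -> 0 < x k ord0 * y k ord0) ->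
  (sc_minus y <= sc_minus x)%N.
Proof.
move=> rx h; have [f hf <-] := sc_minus_attained x.
have [g hg gE] := sc_minus_attained y; rewrite -gE.
rewrite (@regular_changes x g f) //.
move=> k hk; have yk := h k hk.
have yk0 : y k ord0 != 0 by apply: contraTneq yk => ->; rewrite mulr0 ltxx.
rewrite hg //; move: yk; case: (ltrgt0P (x k ord0)) hk => // xk _.
  by rewrite pmulr_rgt0.
by rewrite nmulr_rgt0 // => yk; rewrite ltNge ltW.
Qed.

Lemma changes0 (f : 'I_n -> bool) i j : changes f = 0%N -> f i = f j.
Proof.
move=> h0; have [d [itd _]] := ordS_dist i.
have [_ <-] := itd j; elim: (d j) => //= m ->.
move/eqP: h0; rewrite /changes sum_nat_eq0 => /forallP/(_ (iter m next i)).
by rewrite /= eqb0 negbK => /eqP.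
Qed.

(** Zeros can be filled so that [i] and [j] get different signs. Contraposed: if $s_c^+$ vanishes,
    all entries have one strict sign as soon as $n\ge 2$. *)
Lemma sc_plus_gt0 y i j : i != j -> y i ord0 * y j ord0 <= 0 -> (0 < sc_plus y)%N.
Proof.
move=> ij yij; have hn : (0 < n)%N by apply: leq_ltn_trans (ltn_ord i).
suff [f hf fij] : exists2 f, compat y f & f i != f j.
  apply: leq_trans (sc_plus_ge hn hf); rewrite lt0n.
  by apply: contraNneq fij => /changes0 h; rewrite (h i j).
have [yi|yi] := eqVneq (y i ord0) 0.
  exists (upd (fun k => 0 < y k ord0) i (~~ (0 < y j ord0))).
    by move=> k; rewrite /upd; case: (eqVneq k) => // ->; rewrite yi eqxx.
  by rewrite /upd eqxx [j == i]eq_sym (negbTE ij); case: (0 < _).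
have [yj|yj] := eqVneq (y j ord0) 0.
  exists (upd (fun k => 0 < y k ord0) j (~~ (0 < y i ord0))).
    by move=> k; rewrite /upd; case: (eqVneq k) => // ->; rewrite yj eqxx.
  by rewrite /upd eqxx (negbTE ij); case: (0 < _).
exists (fun k => 0 < y k ord0) => //; rewrite -mul_lt0_sign // lt_neqAle yij.
by rewrite mulf_neq0.
Qed.

Lemma sc_minus_ge0 x : (forall k, 0 <= x k ord0) -> sc_minus x = 0%N.
Proof.
move=> h; apply/eqP; rewrite -leqn0 -(@changes_cst n true) sc_minus_le // => k hk.
by rewrite lt_neqAle eq_sym hk h.
Qed.

Lemma sc_minus_peak x j : (forall k, k != j -> x k ord0 <= 0) -> (sc_minus x <= 2)%N.
Proof.
move=> h.
have hf : compat x (upd (fun=> false) j (0 < x j ord0)).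
  move=> k hk; rewrite /upd; case: eqVneq => [->//|kj].
  by rewrite ltNge h.
apply: leq_trans (sc_minus_le hf) _.
have [/forallP e|/forallPn[k kj]] := boolP [forall k, k == j].
  by rewrite /changes big1 // => k _; rewrite (eqP (e k)) (eqP (e (next j))) eqxx.
have e : prev j != j by rewrite (@prev_neq _ j k) // eq_sym.
have := changes_upd (fun=> false) (0 < x j ord0) e.
by rewrite changes_cst; case: (0 < _) => /=; lia.
Qed.

(** Making [j] negative removes two changes. Were there at most two, the result would be constant,
    yet it is positive at [i] and negative at [j]. *)
Lemma sc_plus_two_peaks y i j : i != j -> i != next j -> i != prev j ->
    0 < y i ord0 -> 0 < y j ord0 -> y (next j) ord0 < 0 -> y (prev j) ord0 < 0 ->
  (2 < sc_plus y)%N.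
Proof.
move=> ij inj ipj yi yj ynj ypj.
have hn : (0 < n)%N by apply: leq_ltn_trans (ltn_ord i).
pose f k := 0 < y k ord0; have hf : compat y f by [].
apply: leq_trans (sc_plus_ge hn hf); rewrite ltnNge; apply/negP => h2.
have pj : prev j != j by rewrite (@prev_neq _ j i) // eq_sym.
have := changes_upd f false pj.
have [fi [fj [fn fp]]] : f i = true /\ f j = true /\
    f (next j) = false /\ f (prev j) = false.
  by rewrite /f yi yj !ltNge !ltW.
rewrite fn fp fj /= => h.
have /changes0 H : changes (upd f j false) = 0%N by move: h2 h; lia.
by have := H i j; rewrite /upd eqxx (negbTE ij) fi.
Qed.

End VariationDiminishing.

Section Neighbours.
Variable n : nat.
Implicit Types i j : 'I_n.

Lemma neighbours_sym i j : neighbours i j = neighbours j i.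
Proof.
have E k l : (k == next l) = (l == prev k).
  by apply/eqP/eqP => ->; rewrite ?ordSK ?ord_predK.
by rewrite /neighbours E [i == next j]E orbC.
Qed.

Lemma neighboursP i j : neighbours i j ->
  [\/ i = j :> nat, j = i.+1 :> nat, i = j.+1 :> nat |
      (i = 0%N :> nat /\ j = n.-1 :> nat) \/ (i = n.-1 :> nat /\ j = 0%N :> nat)].
Proof.
have li := ltn_ord i; have lj := ltn_ord j.
case/orP=> /eqP/(congr1 val) /= e.
  have [h|h] := ltnP i.+1 n; first by rewrite modn_small // in e; constructor 2.
  have E : i.+1 = n by apply/eqP; rewrite eqn_leq li h.
  by rewrite E modnn in e; constructor 4; right; lia.
have [i0|i0] := posnP i.
  by rewrite i0 add0n modn_small in e; [constructor 4; left | lia].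
constructor 3; move: e; rewrite -(prednK i0) addSn /= modnDr modn_small; lia.
Qed.

Lemma neighbours_of_cyclic_tridiagonal (R : realDomainType) (M : 'M[R]_n) i j :
  cyclic_tridiagonal_metzler M -> j != i -> M i j != 0 -> neighbours i j.
Proof.
move=> [_ bM] ji a0; rewrite /neighbours -!val_eqE /=.
have li := ltn_ord i; have lj := ltn_ord j.
have := ji; rewrite -val_eqE /= => ji'.
case: (bM i j a0) => [e|e|e|[[e1 e2]|[e1 e2]]].
- by rewrite e eqxx in ji'.
- by rewrite e modn_small ?eqxx // -e.
- by rewrite e addSn /= modnDr [(j %% n)%N]modn_small ?eqxx ?orbT.
- by rewrite e1 add0n e2 [(n.-1 %% n)%N]modn_small ?eqxx ?orbT //; lia.
- rewrite e1 e2 prednK; last by lia.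
  by rewrite modnn.
Qed.

End Neighbours.

(** * Linear differential equations *)

Section RealAnalysis.
Variable R : realType.
Implicit Types (f g : R -> R) (t p q e : R).

Lemma continuous_eps f t : {for t, continuous f} -> forall e, 0 < e ->
  exists2 d, 0 < d & forall s, `|s - t| < d -> `|f s - f t| < e.
Proof.
move=> cf e e0; have /cvgrPdist_lt/(_ e e0) := cf.
move=> /nbhs_ballP[d /= d0 H]; exists d => // s sd.
by rewrite distrC; apply: H; rewrite /ball /= distrC.
Qed.

Lemma eps_continuous f t : (forall e, 0 < e ->
  exists2 d, 0 < d & forall s, `|s - t| < d -> `|f s - f t| < e) ->
  {for t, continuous f}.
Proof.
move=> H; apply/cvgrPdist_lt => e /H[d d0 {}H].
apply/nbhs_ballP; exists d => //= s; rewrite /ball /= distrC => sd.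
by rewrite distrC; apply: H.
Qed.

Lemma is_derive_continuous f t d : is_derive t 1 f d -> {for t, continuous f}.
Proof.
by move=> [fd _]; apply: differentiable_continuous; apply/derivable1_diffP.
Qed.

Lemma is_derive_eps f t d : is_derive t 1 f d -> forall e, 0 < e ->
  exists2 r, 0 < r & forall h, `|h| < r -> `|f (t + h) - f t - h * d| <= e * `|h|.
Proof.
move=> [fd <-] e e0; move/cvgrPdist_le: fd => /(_ e e0).
rewrite /= -/(derive f t 1) => /nbhs_ballP[r /= r0 H]; exists r => // h hr.
have [->|h0] := eqVneq h 0; first by rewrite addr0 subrr mul0r subrr normr0 mulr0.
have := H h; rewrite /ball /= sub0r normrN => /(_ hr h0).
rewrite [h *: _]mulr1 [h^-1 *: _]mulrC addrC => H1.
rewrite -ler_pdivrMr ?normr_gt0 //; apply: le_trans H1.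
rewrite -normfV -normrM -[leRHS]normrN le_eqVlt; apply/orP; left.
by apply/eqP; congr `|_|; rewrite [h + t]addrC; field.
Qed.

Lemma ger0_derive_le f f' p q : p <= q ->
  (forall t, p <= t <= q -> is_derive t 1 f (f' t)) ->
  (forall t, p <= t <= q -> 0 <= f' t) -> f p <= f q.
Proof.
rewrite le_eqVlt => /orP[/eqP ->//|pq] fd f0.
have [x|x|c] := @MVT _ f f' p q pq.
- rewrite in_itv /= => /andP[x1 x2]; apply: fd; lra.
- apply: continuous_in_subspaceT => t; rewrite inE /= in_itv /= => tpq.
  exact: is_derive_continuous (fd t tpq).
- rewrite in_itv /= => /andP[x1 x2] E; rewrite -subr_ge0 E mulr_ge0 // ?f0; lra.
Qed.

Lemma is_derive_fctM f g t a b : is_derive t 1 f a -> is_derive t 1 g b ->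
  is_derive t 1 (fun s => f s * g s) (a * g t + f t * b).
Proof.
move=> fa gb; have := @is_deriveM _ _ f g t 1 a b fa gb.
by move/is_derive_eq; apply; rewrite /GRing.scale /= addrC [g t * _]mulrC.
Qed.

Lemma is_derive_fct_sum (I : Type) (r : seq I) (f : I -> R -> R) t (a : I -> R) :
  (forall i, is_derive t 1 (f i) (a i)) ->
  is_derive t 1 (fun s => \sum_(i <- r) f i s) (\sum_(i <- r) a i).
Proof.
move=> fa; elim: r => [|i r IH].
  rewrite big_nil (_ : (fun _ => _) = cst 0); first exact: is_derive_cst.
  by apply/funext => s; rewrite big_nil.
rewrite big_cons (_ : (fun _ => _) = f i + (fun s => \sum_(i <- r) f i s)).
  exact: is_deriveD.
by apply/funext => s; rewrite big_cons.
Qed.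

Lemma is_derive_expRM c t : is_derive t 1 (fun s => expR (c * s)) (expR (c * t) * c).
Proof.
have h1 : is_derive t 1 (fun s => c * s) c.
  have := is_derive_fctM (is_derive_cst c t 1) (is_derive_id t 1).
  by rewrite mul0r add0r mulr1.
have h2 := is_derive_expR (c * t).
have := @is_derive1_comp _ expR (fun s => c * s) t _ _ h2 h1.
by move/is_derive_eq; apply.
Qed.

(** Gronwall argument: [f] times $e^{-Kt}$ decreases, which settles times after [t0], and [f] times
    $e^{Kt}$ increases, which settles times before. *)
Lemma derive_dominated_eq0 f f' (K : R) p q t0 t :
  (forall t, p <= t <= q -> is_derive t 1 f (f' t)) ->
  (forall t, p <= t <= q -> 0 <= f t /\ `|f' t| <= K * f t) ->
  p <= t0 <= q -> p <= t <= q -> f t0 = 0 -> f t = 0.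
Proof.
move=> fd fK t0pq tpq f0.
have [_ ft0] : True /\ 0 <= f t by split => //; case: (fK t tpq).
have dexp (c s : R) : p <= s <= q -> is_derive s 1 (fun s => f s * expR (c * s))
    ((f' s + c * f s) * expR (c * s)).
  move=> /fd fds; have := is_derive_fctM fds (is_derive_expRM c s).
  by move/is_derive_eq; apply; ring.
have [tt0|tt0] := leP t0 t.
  have : f t * expR (- K * t) <= f t0 * expR (- K * t0).
    rewrite -lerN2; apply: (@ger0_derive_le (fun s => - (f s * expR (- K * s)))
       (fun s => - ((f' s + - K * f s) * expR (- K * s)))) => // s st.
      by apply: is_deriveN; apply: dexp; lra.
    have [_ ] : 0 <= f s /\ `|f' s| <= K * f s by apply: fK; lra.
    rewrite ler_norml => /andP[h1 h2]; rewrite -mulNr mulr_ge0 ?expR_ge0 //; lra.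
  rewrite f0 mul0r pmulr_lle0 ?expR_gt0 // => h; lra.
have : f t * expR (K * t) <= f t0 * expR (K * t0).
  apply: (@ger0_derive_le (fun s => (f s * expR (K * s)))
     (fun s => ((f' s + K * f s) * expR (K * s)))) => [|s st|s st].
  - lra.
  - by apply: dexp; lra.
  - have [_ ] : 0 <= f s /\ `|f' s| <= K * f s by apply: fK; lra.
    rewrite ler_norml => /andP[h1 h2]; rewrite mulr_ge0 ?expR_ge0 //; lra.
rewrite f0 mul0r pmulr_lle0 ?expR_gt0 // => h; lra.
Qed.

(** The sum of squares satisfies $|E'|\le 2MnE$. Only a bound on the derivatives is assumed, so the
    lemma also applies to a part of the coordinates with the others replaced by zero. *)
Lemma linear_ode_unique n (v v' : 'I_n -> R -> R) (M p q t0 : R) :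
  0 <= M ->
  (forall i t, p <= t <= q -> is_derive t 1 (v i) (v' i t)) ->
  (forall i t, p <= t <= q -> `|v' i t| <= M * \sum_j `|v j t|) ->
  p <= t0 <= q -> (forall i, v i t0 = 0) ->
  forall i t, p <= t <= q -> v i t = 0.
Proof.
move=> M0 vd vM t0pq v0 i t tpq.
pose E t := \sum_(j < n) v j t ^+ 2.
have E0 s : 0 <= E s by apply: sumr_ge0 => j _; exact: sqr_ge0.
suff : E t = 0.
  move/eqP; rewrite psumr_eq0; last by move=> j _; exact: sqr_ge0.
  by move=> /allP/(_ i); rewrite mem_index_enum sqrf_eq0 => /(_ isT)/eqP.
pose E' t := \sum_(j < n) 2 * v j t * v' j t.
apply: (@derive_dominated_eq0 E E' (2 * M * n%:R) p q t0) => //; last first.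
  by rewrite /E big1 // => j _; rewrite v0 expr0n.
- move=> s spq; split=> //.
  have Ms j : `|2 * v j s * v' j s| <= M * \sum_k (v j s ^+ 2 + v k s ^+ 2).
    rewrite !normrM ger0_norm // -mulrA.
    have h := vM j s spq.
    apply: (@le_trans _ _ (2 * (`|v j s| * (M * \sum_k `|v k s|)))).
      by rewrite ler_pM2l // ler_wpM2l.
    rewrite [leLHS](_ : _ = M * \sum_k (2 * `|v j s| * `|v k s|)); last first.
      by rewrite -mulr_sumr; ring.
    rewrite ler_wpM2l // ler_sum // => k _.
    rewrite -[v j s ^+ 2]real_normK ?num_real // -[v k s ^+ 2]real_normK ?num_real //.
    have := sqr_ge0 (`|v j s| - `|v k s|); rewrite sqrrB -mulr_natl; lra.
  apply: le_trans (ler_norm_sum _ _ _) _; apply: le_trans (ler_sum _ (fun j _ => Ms j)) _.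
  have -> : \sum_j M * \sum_k (v j s ^+ 2 + v k s ^+ 2) = 2 * M * n%:R * E s => //.
  rewrite -mulr_sumr; under eq_bigr do rewrite big_split /= sumr_const card_ord -mulr_natl.
  rewrite big_split /= sumr_const card_ord -mulr_natl -mulr_sumr -/(E s).
  by ring.
- move=> s spq; apply: is_derive_fct_sum => j; have vjd := vd j s spq.
  have -> : (fun s => v j s ^+ 2) = (fun s => v j s * v j s).
    by apply/funext => u; rewrite expr2.
  by apply: is_derive_eq (is_derive_fctM vjd vjd) _; ring.
Qed.

(** The functions are treated one at a time: one that is nonzero at some point of the current
    interval stays nonzero near that point, and later shrinking preserves both alternatives. *)
Lemma shrink_interval_seq (I : Type) (r : seq I) (f : I -> R -> R) p q : p < q ->
  (forall i t, p <= t <= q -> {for t, continuous (f i)}) ->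
  exists p' q' : R, [/\ p <= p', p' < q', q' <= q &
    List.Forall (fun i => (forall t, p' <= t <= q' -> f i t = 0) \/
               (forall t, p' <= t <= q' -> f i t != 0)) r].
Proof.
move=> pq fc; elim: r => [|i r [p1 [q1 [pp1 pq1 qq1 IH]]]].
  by exists p, q; split.
have [[t [t1 ft]]|h0] := pselect (exists t, p1 <= t <= q1 /\ f i t != 0); last first.
  exists p1, q1; split => //; constructor => //; left => t t1.
  by apply/eqP; apply: contraPT h0 => ft; apply; exists t.
have ft0 : 0 < `|f i t| by rewrite normr_gt0.
have tpq : p <= t <= q by lra.
have [d d0 H] := continuous_eps (fc i t tpq) ft0.
have nz s : `|s - t| < d -> f i s != 0.
  by move=> /H; apply: contraTneq => ->; rewrite sub0r normrN ltxx.
(* Half of [d] keeps the closed interval inside the open ball; [t] may be an end point of the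
   current interval, hence the maximum and minimum. *)
pose p2 := Num.max p1 (t - d / 2); pose q2 := Num.min q1 (t + d / 2).
have [h1 h2] : p1 <= p2 /\ t - d / 2 <= p2 by rewrite /p2; split; rewrite le_max lexx ?orbT.
have [h3 h4] : q2 <= q1 /\ q2 <= t + d / 2 by rewrite /q2; split; rewrite ge_min lexx ?orbT.
have h5 : p2 < q2.
  by rewrite /p2 /q2 gt_max !lt_min; apply/andP; split; apply/andP; split; lra.
exists p2, q2; split => //; try lra.
constructor; first by right=> s s1; apply: nz; rewrite ltr_norml; lra.
apply: List.Forall_impl IH => j [h|h]; [left|right] => s s1; apply: h; lra.
Qed.

Lemma shrink_interval (I : finType) (f : I -> R -> R) p q : p < q ->
  (forall i t, p <= t <= q -> {for t, continuous (f i)}) ->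
  exists p' q' : R, [/\ p <= p', p' < q', q' <= q &
    forall i, (forall t, p' <= t <= q' -> f i t = 0) \/
               (forall t, p' <= t <= q' -> f i t != 0)].
Proof.
move=> pq /(shrink_interval_seq (enum I) pq)[p' [q' [h1 h2 h3 h4]]].
exists p', q'; split=> // i; have : i \in enum I by rewrite mem_enum.
elim: h4 => [//|j r h _ IH]; rewrite inE => /orP[/eqP ->//|]; exact: IH.
Qed.

Lemma bounded_segment f p q : p <= q ->
  (forall t, p <= t <= q -> {for t, continuous f}) ->
  exists2 M, 0 <= M & forall t, p <= t <= q -> `|f t| <= M.
Proof.
move=> pq fc.
have wc : {within `[p, q], continuous (fun t => `|f t|)}.
  apply: continuous_in_subspaceT => t; rewrite inE /= in_itv /= => tpq.
  apply: continuous_comp (fc t tpq) _; exact: norm_continuous.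
have [c _ H] := EVT_max pq wc.
by exists `|f c| => // t tpq; apply: H; rewrite in_itv.
Qed.

Lemma bounded_segment_fin (I : finType) (f : I -> R -> R) p q : p <= q ->
  (forall i t, p <= t <= q -> {for t, continuous (f i)}) ->
  exists2 M, 0 <= M & forall i t, p <= t <= q -> `|f i t| <= M.
Proof.
move=> pq fc.
have H i : exists M, 0 <= M /\ forall t, p <= t <= q -> `|f i t| <= M.
  by have [M M0 h] := bounded_segment pq (fc i); exists M.
have [B hB] := choice H.
exists (\sum_i B i); first by apply: sumr_ge0 => i _; case: (hB i).
move=> i t tpq; apply: le_trans (_ : B i <= _); first by case: (hB i) => _; apply.
by rewrite (bigD1 i) //= lerDl sumr_ge0 // => j _; case: (hB j).
Qed.

Lemma primitive_exists f p q t0 : p <= q -> continuous f ->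
  exists2 F : R -> R, F t0 = 0 & forall t, p <= t <= q -> is_derive t 1 F (f t).
Proof.
move=> pq fc.
pose mu := @lebesgue_measure R.
(* Integrating from [p - 1] inside [[p - 1, q + 1]] makes every point of [[p, q]] interior, which
   gives two-sided derivatives at [p] and [q] too. *)
pose F x := (\int[mu]_(t in [set` `[p - 1, x]]) (f t))%R.
exists (fun x => F x - F t0); first by rewrite subrr.
move=> t tpq.
have fint : mu.-integrable `[p - 1, q + 1] (EFin \o f).
  apply: continuous_compact_integrable; first exact: segment_compact.
  exact: continuous_subspaceT.
have [||dF DF] := @continuous_FTC1_closed R f (p - 1) t (q + 1) _ fint _ (fc t).
- lra.
- lra.
have : is_derive t 1 F (f t).
  by split => //; rewrite -DF derive1E.
move=> h; have := @is_deriveB _ _ _ F (cst (F t0)) t 1 _ _ h (is_derive_cst _ _ _).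
by rewrite subr0.
Qed.

End RealAnalysis.

(** * Existence of solutions on a compact interval by Picard iteration *)

Section Picard.
Variable R : realType.
Implicit Types (f g : R -> R) (t p q e : R).

Lemma is_derive_fctB f g t a b : is_derive t 1 f a -> is_derive t 1 g b ->
  is_derive t 1 (fun s => f s - g s) (a - b).
Proof. by move=> fa gb; exact: is_deriveB. Qed.

Lemma is_derive_fctD f g t a b : is_derive t 1 f a -> is_derive t 1 g b ->
  is_derive t 1 (fun s => f s + g s) (a + b).
Proof. by move=> fa gb; exact: is_deriveD. Qed.

(** Composition with this projection onto [[p, q]] extends a function continuously to the whole
    line. *)
Definition clamp p q t := Num.max p (Num.min q t).

Lemma clamp_in p q t : p <= q -> p <= clamp p q t <= q.
Proof. by move=> pq; rewrite /clamp le_max lexx ge_max pq ge_min lexx. Qed.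

Lemma clamp_id p q t : p <= t <= q -> clamp p q t = t.
Proof. by move=> /andP[pt tq]; rewrite /clamp (min_idPr tq) (max_idPr pt). Qed.

Lemma clamp_lip p q s t : `|clamp p q s - clamp p q t| <= `|s - t|.
Proof.
rewrite /clamp; case: (leP q s) => h1; case: (leP q t) => h2;
  rewrite ?subrr ?normr0 ?normr_ge0 //.
- case: (leP p q) => h3; case: (leP p t) => h4; rewrite ler_norml; case: (ger0P (s - t)); lra.
- case: (leP p s) => h3; case: (leP p q) => h4; rewrite ler_norml; case: (ger0P (s - t)); lra.
- case: (leP p s) => h3; case: (leP p t) => h4; rewrite ler_norml; case: (ger0P (s - t)); lra.
Qed.

Lemma continuous_clamp f p q : p <= q ->
  (forall t, p <= t <= q -> {for t, continuous f}) ->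
  continuous (fun t => f (clamp p q t)).
Proof.
move=> pq fc t; apply: eps_continuous => e e0.
have [d d0 H] := continuous_eps (fc _ (clamp_in t pq)) e0.
by exists d => // s st; apply: H; apply: le_lt_trans (clamp_lip _ _ _ _) st.
Qed.

Lemma primitive_segment f p q t0 : p <= q ->
  (forall t, p <= t <= q -> {for t, continuous f}) ->
  exists2 F : R -> R, F t0 = 0 & forall t, p <= t <= q -> is_derive t 1 F (f t).
Proof.
move=> pq fc; have [F F0 HF] := primitive_exists t0 pq (continuous_clamp pq fc).
by exists F => // t tpq; rewrite -{2}(clamp_id tpq); exact: HF.
Qed.

(* [2 cosh (L (t - t0))]: in the norm weighted by it, the Picard map is a
   contraction on both sides of [t0]. *)
Definition weight (L t0 t : R) :=
  expR (- (L * t0)) * expR (L * t) + expR (L * t0) * expR (- L * t).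

Lemma weight_ge1 L t0 t : 1 <= weight L t0 t.
Proof.
rewrite /weight -!expRD; have [h|h] := leP 0 (L * t - L * t0).
  by rewrite -[leLHS]addr0 lerD ?expR_ge0 // -expR0 ler_expR; lra.
by rewrite -[leLHS]add0r lerD ?expR_ge0 // -expR0 ler_expR; lra.
Qed.

Lemma continuous_weight L t0 t : {for t, continuous (weight L t0)}.
Proof.
have h1 := is_derive_fctM (is_derive_cst (expR (- (L * t0))) t 1) (is_derive_expRM L t).
have h2 := is_derive_fctM (is_derive_cst (expR (L * t0)) t 1) (is_derive_expRM (- L) t).
exact: is_derive_continuous (is_derive_fctD h1 h2).
Qed.

(** Comparison with the primitive [v] of the weight that vanishes at [t0], namely
    $2\sinh(L(t-t_0))/L$, whose absolute value is at most the weight divided by [L]. *)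
Lemma growth_bound L t0 p q a f f' : 0 < L -> 0 <= a -> p <= t0 <= q ->
  (forall t, p <= t <= q -> is_derive t 1 f (f' t)) -> f t0 = 0 ->
  (forall t, p <= t <= q -> `|f' t| <= a * weight L t0 t) ->
  forall t, p <= t <= q -> `|f t| <= a / L * weight L t0 t.
Proof.
move=> L0 a0 t0pq.
pose v t := (expR (- (L * t0)) * expR (L * t) - expR (L * t0) * expR (- L * t)) / L.
have vd t : is_derive t 1 v (weight L t0 t).
  have h1 := is_derive_fctM (is_derive_cst (expR (- (L * t0))) t 1) (is_derive_expRM L t).
  have h2 := is_derive_fctM (is_derive_cst (expR (L * t0)) t 1) (is_derive_expRM (- L) t).
  have h3 := is_derive_fctM (is_derive_fctB h1 h2) (is_derive_cst L^-1 t 1).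
  apply: is_derive_eq h3 _; rewrite /weight /=; field; exact: lt0r_neq0.
have v0 : v t0 = 0.
  by rewrite /v -!expRD mulNr subrr addNr subrr mul0r.
have vw t : `|v t| <= weight L t0 t / L.
  rewrite /v normrM [`|L^-1|]gtr0_norm ?invr_gt0 // ler_pM2r ?invr_gt0 //.
  rewrite /weight; apply: le_trans (ler_normB _ _) _.
  by rewrite !ger0_norm ?mulr_ge0 ?expR_ge0.
clearbody v.
have H g g' : (forall t, p <= t <= q -> is_derive t 1 g (g' t)) -> g t0 = 0 ->
  (forall t, p <= t <= q -> `|g' t| <= a * weight L t0 t) ->
  forall t, p <= t <= q -> g t <= a * `|v t|.
  move=> gd g0 gw t tpq.
  have dm b s : p <= s <= q -> is_derive s 1 (fun s => b * v s - g s) (b * weight L t0 s - g' s).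
    move=> spq; apply: is_derive_fctB _ (gd s spq).
  have [tt0|tt0] := leP t0 t.
    have : a * v t0 - g t0 <= a * v t - g t.
      apply: (@ger0_derive_le R (fun s => a * v s - g s)
        (fun s => a * weight L t0 s - g' s)) => // s st.
        by apply: dm; lra.
      have /gw : p <= s <= q by lra.
      by rewrite ler_norml => /andP[]; lra.
    rewrite v0 g0 => h; have := ler_wpM2l a0 (ler_norm (v t)); lra.
  have : (- a) * v t0 - g t0 <= (- a) * v t - g t.
    rewrite -lerN2.
    apply: (@ger0_derive_le R (fun s => - (- a * v s - g s))
      (fun s => - (- a * weight L t0 s - g' s))) => [|s st|s st].
    - exact: ltW.
    - by apply: is_deriveN; apply: dm; lra.
    - have /gw : p <= s <= q by lra.
      by rewrite ler_norml => /andP[]; lra.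
  rewrite v0 g0 => h; have := ler_wpM2l a0 (ler_norm (- v t)); rewrite normrN; lra.
move=> fd f0 fw t tpq.
have : `|f t| <= a * `|v t|.
  rewrite ler_norml; apply/andP; split; last exact: H fd f0 fw t tpq.
  rewrite lerNl; apply: (H (fun s => - f s) (fun s => - f' s)) => //.
  - by move=> s spq; apply: is_deriveN; exact: fd.
  - by rewrite f0 oppr0.
  - by move=> s spq; rewrite normrN; exact: fw.
move/le_trans; apply; rewrite -mulrA ler_wpM2l // mulrC; exact: vw.
Qed.

(** The intervals with centre [u k] and radius [2 * A * 2^-1 ^+ k] are nested; the limit is the
    supremum of their left ends. *)
Lemma geometric_limit (u : nat -> R) (A : R) :
  (forall k, `|u k.+1 - u k| <= A * 2^-1 ^+ k) ->
  exists l, forall k, `|l - u k| <= 2 * A * 2^-1 ^+ k.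
Proof.
move=> uA.
pose x k := u k - 2 * A * 2^-1 ^+ k; pose y k := u k + 2 * A * 2^-1 ^+ k.
have A0 : 0 <= A by have := uA 0%N; rewrite expr0 mulr1; apply: le_trans.
have xS k : x k <= x k.+1.
  by have := uA k; rewrite ler_norml /x exprS => /andP[h1 h2]; lra.
have yS k : y k.+1 <= y k.
  by have := uA k; rewrite ler_norml /y exprS => /andP[h1 h2]; lra.
have xm k m : (k <= m)%N -> x k <= x m.
  by move=> km; apply: (@homo_leq _ x _ lexx le_trans).
have ym k m : (k <= m)%N -> y m <= y k.
  move=> km; apply: (@homo_leq _ y (fun a b => b <= a)) => // a b c h1 h2.
  exact: le_trans h2 h1.
have xy k m : x k <= y m.
  apply: le_trans (xm _ _ (leq_maxl k m)) _; apply: le_trans (ym _ _ (leq_maxr k m)).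
  have h : 0 <= (2^-1 : R) ^+ maxn k m by rewrite exprn_ge0 // invr_ge0.
  by have := mulr_ge0 A0 h; rewrite /x /y; lra.
have hs : has_sup (range x).
  by split; [exists (x 0%N), 0%N | exists (y 0%N) => _ [k _ <-]].
exists (sup (range x)) => k.
have h1 : x k <= sup (range x) by apply: sup_upper_bound => //; exists k.
have h2 : sup (range x) <= y k.
  by apply: ge_sup; [exists (x 0%N), 0%N | move=> _ [m _ <-]].
by rewrite ler_norml; move: h1 h2; rewrite /x /y; lra.
Qed.

Lemma half_pow_small (A e : R) : 0 < e -> exists k, A * 2^-1 ^+ k < e.
Proof.
move=> e0; have [A0|A0] := leP A 0.
  exists 0%N; rewrite expr0 mulr1; lra.
have : (fun k => A * (2^-1 : R) ^+ k) @ \oo --> (A * 0 : R).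
  apply: cvgM; first exact: cvg_cst.
  by apply: cvg_expr; rewrite ger0_norm ?invr_ge0 // invf_lt1 // ltr1n.
rewrite mulr0 => /cvgrPdist_lt/(_ e e0)[k _ /(_ k (leqnn k))] /=.
rewrite sub0r normrN => /(le_lt_trans (ler_norm _)) h.
by exists k.
Qed.

Lemma continuous_fct_sum (I : Type) (r : seq I) (f : I -> R -> R) t :
  (forall i, {for t, continuous (f i)}) ->
  {for t, continuous (fun s => \sum_(i <- r) f i s)}.
Proof.
move=> fc; elim: r => [|i r IH].
  rewrite (_ : (fun _ => _) = cst 0); first exact: cvg_cst.
  by apply/funext => s; rewrite big_nil.
rewrite (_ : (fun _ => _) = f i + (fun s => \sum_(i <- r) f i s)).
  exact: continuousD.
by apply/funext => s; rewrite big_cons.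
Qed.

Lemma ode_segment n (B : 'I_n -> 'I_n -> R -> R) (x0 : 'I_n -> R) p q t0 :
  p <= t0 <= q ->
  (forall i j t, p <= t <= q -> {for t, continuous (B i j)}) ->
  exists2 u : 'I_n -> R -> R, forall i, u i t0 = x0 i &
    forall i t, p <= t <= q -> is_derive t 1 (u i) (\sum_j B i j t * u j t).
Proof.
move=> t0pq Bc; have pq : p <= q by lra.
pose cont (u : 'I_n -> R -> R) := forall i t, p <= t <= q -> {for t, continuous (u i)}.
pose rhs (u : 'I_n -> R -> R) i t := \sum_j B i j t * u j t.
have rhs_cont u : cont u -> forall i t, p <= t <= q -> {for t, continuous (rhs u i)}.
  move=> uc i t tpq; rewrite /rhs.
  apply: continuous_fct_sum => j.
  apply: continuousM; [exact: Bc | exact: uc].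
(* This yields the Picard map [T]; its specification is conditional on a continuous argument, and
   for other arguments the value is arbitrary. *)
have step u : exists w : 'I_n -> R -> R, cont u ->
    (forall i, w i t0 = x0 i) /\
    forall i t, p <= t <= q -> is_derive t 1 (w i) (rhs u i t).
  have [uc|nc] := pselect (cont u); last by exists u.
  have H i : exists F : R -> R, F t0 = 0 /\ forall t, p <= t <= q -> is_derive t 1 F (rhs u i t).
    by have [F F0 HF] := primitive_segment t0 pq (rhs_cont u uc i); exists F.
  have [F hF] := choice H.
  exists (fun i t => x0 i + F i t) => _; split=> [i|i t tpq].
    by case: (hF i) => ->; rewrite addr0.
  have [_ /(_ t tpq) h] := hF i.
  by rewrite -[rhs u i t]add0r; apply: is_derive_fctD h; exact: is_derive_cst.
have [T hT] := choice step.
pose u k := iter k T (fun i _ => x0 i).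
have uc k : cont (u k).
  elim: k => [|k IH] i t tpq; first exact: cvg_cst.
  by have [_ /(_ i t tpq)] := hT _ IH; exact: is_derive_continuous.
have uS k i t : p <= t <= q -> is_derive t 1 (u k.+1 i) (rhs (u k) i t).
  by move=> tpq; have [_ /(_ i t tpq)] := hT _ (uc k).
have ut0 k i : u k i t0 = x0 i.
  by case: k => // k; have [/(_ i)] := hT _ (uc k).
have [M M0 hM] : exists2 M, 0 <= M & forall i j t, p <= t <= q -> `|B i j t| <= M.
  have [M M0 h] := @bounded_segment_fin R ('I_n * 'I_n)%type
    (fun ij => B ij.1 ij.2) p q pq (fun ij => Bc _ _).
  by exists M => // i j; exact: (h (i, j)).
(* Since $nM\le L/2$, the right-hand side has Lipschitz constant at most $L/2$; [growth_bound]
   divides by [L], so each iteration gains a factor $1/2$. *)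
pose L := 2 * n%:R * M + 1.
have L0 : 0 < L by rewrite /L ltr_wpDl // !mulr_ge0.
have [C C0 hC] : exists2 C, 0 <= C & forall i t, p <= t <= q -> `|u 1%N i t - u 0%N i t| <= C.
  apply: (bounded_segment_fin pq (f := fun i t => u 1%N i t - u 0%N i t)) => i t tpq.
  by apply: continuousB; exact: uc.
have rhs_bound (y z : 'I_n -> R -> R) a i t : p <= t <= q -> 0 <= a ->
    (forall j, `|y j t - z j t| <= a) -> `|rhs y i t - rhs z i t| <= L / 2 * a.
  move=> tpq a0 yz; rewrite /rhs -sumrB.
  apply: le_trans (ler_norm_sum _ _ _) _.
  apply: (@le_trans _ _ (\sum_(j < n) M * a)).
    by apply: ler_sum => j _; rewrite -mulrBr normrM ler_pM // hM.
  rewrite sumr_const card_ord -[leLHS]mulr_natl mulrA ler_wpM2r // /L; lra.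
have w0 t : 0 <= weight L t0 t by apply: le_trans (weight_ge1 _ _ _).
have uk k i t : p <= t <= q -> `|u k.+1 i t - u k i t| <= C * 2^-1 ^+ k * weight L t0 t.
  elim: k i t => [|k IH] i t tpq.
    rewrite expr0 mulr1; apply: le_trans (hC i t tpq) _.
    by rewrite ler_peMr // weight_ge1.
  have Ck : 0 <= C * 2^-1 ^+ k by rewrite mulr_ge0 // exprn_ge0 // invr_ge0.
  have := @growth_bound L t0 p q (L / 2 * (C * 2^-1 ^+ k)) (fun t => u k.+2 i t - u k.+1 i t)
    (fun t => rhs (u k.+1) i t - rhs (u k) i t) L0 _ t0pq.
  have -> : L / 2 * (C * 2^-1 ^+ k) / L = C * 2^-1 ^+ k.+1.
    by rewrite exprS; field; exact: lt0r_neq0.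
  apply => //.
  - by rewrite mulr_ge0 // divr_ge0 // ltW.
  - by move=> s spq; apply: is_derive_fctB; exact: uS.
  - by rewrite !ut0 subrr.
  - move=> s spq; rewrite -mulrA; apply: rhs_bound => // [|j]; last exact: IH.
    by rewrite mulr_ge0.
have [W W0 hW] : exists2 W, 0 <= W & forall t, p <= t <= q -> `|weight L t0 t| <= W.
  by apply: bounded_segment => // t _; exact: continuous_weight.
(* Limits are taken at clamped times, so that [V] is defined on the whole line and two-sided
   continuous at [p] and [q]. *)
have lim_ex i t : exists l, forall k, `|l - u k i (clamp p q t)| <= 2 * (C * W) * 2^-1 ^+ k.
  apply: geometric_limit => k; have tpq := clamp_in t pq.
  apply: le_trans (uk k i _ tpq) _.
  rewrite -mulrA [_ * weight _ _ _]mulrC mulrA ler_wpM2r ?exprn_ge0 ?invr_ge0 //.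
  by rewrite ler_wpM2l //; apply: le_trans (ler_norm _) (hW _ tpq).
have [v hv] := choice (fun it : 'I_n * R => lim_ex it.1 it.2).
pose V i t := v (i, t); set A := 2 * (C * W) in hv.
have A0 : 0 <= A by rewrite !mulr_ge0.
have hV i t k : p <= t <= q -> `|V i t - u k i t| <= A * 2^-1 ^+ k.
  by move=> tpq; rewrite -{2}(clamp_id tpq); exact: (hv (i, t)).
have Vc : cont V.
  move=> i t tpq; apply: eps_continuous => e e0.
  have e3 : 0 < e / 3 by lra.
  have [k hk] := half_pow_small A e3.
  have cc : continuous (fun s => u k i (clamp p q s)) by exact: (continuous_clamp pq (uc k i)).
  have [d d0 H] := continuous_eps (cc t) e3.
  exists d => // s /H h; have h1 := hv (i, s) k; have h2 := hv (i, t) k.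
  move: h h1 h2; rewrite /= -/(V i s) -/(V i t); set a := u k i _; set b := u k i _ => h h1 h2.
  have -> : V i s - V i t = (V i s - a) + (a - b) - (V i t - b) by ring.
  apply: le_lt_trans (ler_normB _ _) _.
  by have := ler_normD (V i s - a) (a - b); lra.
have [Ut0 Ud] := hT _ Vc.
exists (T V) => // i t tpq.
suff E j s : p <= s <= q -> T V j s = V j s.
  by have := Ud i t tpq; rewrite /rhs; under eq_bigr => j _ do rewrite -(E j t tpq).
(* Both [T V] and [V] are limits of the iterates: the contraction estimate bounds the distance from
   [T V] to [u k.+1]. *)
move=> spq; apply/eqP; rewrite -subr_eq0 -normr_le0; apply/ler_addgt0Pl => e e0.
rewrite addr0.
have [k hk] := half_pow_small (A * (W + 1)) e0.
have h1 : `|T V j s - u k.+1 j s| <= (L / 2 * (A * 2^-1 ^+ k)) / L * weight L t0 s.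
  apply: (@growth_bound L t0 p q _ (fun s => T V j s - u k.+1 j s)
    (fun s => rhs V j s - rhs (u k) j s)) => //.
  - by rewrite !mulr_ge0 ?exprn_ge0 ?invr_ge0 // ltW.
  - by move=> r rpq; apply: is_derive_fctB; [exact: Ud | exact: uS].
  - by rewrite Ut0 ut0 subrr.
  - move=> r rpq; apply: le_trans (rhs_bound _ _ (A * 2^-1 ^+ k) j r rpq _ _) _.
    + by rewrite !mulr_ge0 ?exprn_ge0 ?invr_ge0.
    + by move=> i'; exact: hV.
    + by rewrite ler_peMr ?weight_ge1 // !mulr_ge0 ?exprn_ge0 ?invr_ge0 // ltW.
have h2 := hV j s k.+1 spq.
have -> : T V j s - V j s = (T V j s - u k.+1 j s) - (V j s - u k.+1 j s) by ring.
apply: le_trans (ler_normB _ _) _; apply: le_trans (lerD h1 h2) _.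
apply: le_trans (ltW hk).
have -> : L / 2 * (A * 2^-1 ^+ k) / L * weight L t0 s = A * 2^-1 ^+ k * (weight L t0 s / 2).
  by field; exact: lt0r_neq0.
rewrite [2^-1 ^+ k.+1]exprS.
have -> : A * 2^-1 ^+ k * (weight L t0 s / 2) + A * (2^-1 * 2^-1 ^+ k) =
   A * 2^-1 ^+ k * (weight L t0 s / 2 + 2^-1) by ring.
have -> : A * (W + 1) * 2^-1 ^+ k = A * 2^-1 ^+ k * (W + 1) by ring.
rewrite ler_wpM2l ?mulr_ge0 ?exprn_ge0 ?invr_ge0 //.
have := hW s spq; have := ler_norm (weight L t0 s); lra.
Qed.

End Picard.

(** * The open interval with possibly infinite ends *)

Section Ooset.
Variables (R : realType) (a b : \bar R).

Lemma ooset_itv (p q t : R) : ooset a b p -> ooset a b q -> p <= t <= q -> ooset a b t.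
Proof.
move=> [ap _] [_ qb] /andP[pt tq]; split.
- by apply: lt_le_trans ap _; rewrite lee_fin.
- by apply: le_lt_trans qb; rewrite lee_fin.
Qed.

Lemma ooset_nbhd (t : R) : ooset a b t -> exists p q,
  [/\ ooset a b p, p < t, t < q & ooset a b q].
Proof.
move=> [at_ tb].
have [p [ap pt]] : exists p : R, (a < p%:E)%E /\ p < t.
  case: a at_ => [r| |] //; rewrite ?lte_fin => h.
    by exists ((r + t) / 2); rewrite lte_fin; lra.
  by exists (t - 1); rewrite ltNyr; split => //; lra.
have [q [qb tq]] : exists q : R, (q%:E < b)%E /\ t < q.
  case: b tb => [r| |] //; rewrite ?lte_fin => h.
    by exists ((r + t) / 2); rewrite lte_fin; lra.
  by exists (t + 1); rewrite ltry; split => //; lra.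
exists p, q; split => //; split => //.
- by apply: lt_trans tb; rewrite lte_fin.
- by apply: lt_trans at_ _; rewrite lte_fin.
Qed.

Lemma ooset_open : open (ooset a b).
Proof.
rewrite openE => t /ooset_nbhd[p [q [hp pt tq hq]]].
rewrite /interior; near=> s; apply: (ooset_itv hp hq); apply/andP; split; apply: ltW.
- by near: s; exact: lt_nbhsr.
- by near: s; exact: lt_nbhsl.
Unshelve. all: by end_near. Qed.

Lemma entry_continuous n (A : R -> 'M[R]_n) : {within ooset a b, continuous A} ->
  forall i j t, ooset a b t -> {for t, continuous (fun s => A s i j)}.
Proof.
move=> hA i j t tab.
have At : {for t, continuous A}.
  by move: hA; rewrite continuous_open_subspace; [apply; rewrite inE|exact: ooset_open].
exact: (@continuous_comp _ _ _ A (fun M => M i j) t At (@coord_continuous _ _ _ i j (A t))).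
Qed.

End Ooset.

Lemma is_derive_mxP (R : realType) m n (P : R -> 'M[R]_(m, n)) (t : R) D :
  is_derive (t : R^o) 1 P D <-> forall i j, is_derive t 1 (fun s => P s i j) (D i j).
Proof.
split=> [[Pd PD] i j|H].
  have h := (derivable_mxP P (t : R^o) 1).1 Pd i j.
  by split; [exact: h | rewrite -PD derive_mx // mxE].
have Pd : derivable (P : R^o -> _) t 1 by apply/derivable_mxP => i j; case: (H i j).
split=> //; rewrite derive_mx //; apply/matrixP => i j; rewrite mxE.
by case: (H i j).
Qed.

(** * Global solutions and the transition matrix *)

Section Flow.
Variables (R : realType) (n : nat) (a b : \bar R) (A : R -> 'M[R]_n).
Hypothesis hA : {within ooset a b, continuous A}.
Local Notation I := (ooset a b).

Definition trajectory (x : R -> 'cV[R]_n) (t : R) :=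
  forall i, is_derive t 1 (fun s => x s i ord0) ((A t *m x t) i ord0).

Lemma entries_bounded p q : I p -> I q -> p <= q -> exists2 M, 0 <= M &
  forall i j t, p <= t <= q -> `|A t i j| <= M.
Proof.
move=> hp hq pq.
have [|M M0 h] := @bounded_segment_fin R ('I_n * 'I_n)%type (fun ij s => A s ij.1 ij.2) p q pq.
  by move=> ij t tpq; apply: entry_continuous hA _ _ _ _; exact: ooset_itv hp hq tpq.
by exists M => // i j; exact: (h (i, j)).
Qed.

Lemma trajectory_eq0 (x : R -> 'cV[R]_n) p q t0 : I p -> I q ->
  (forall t, p <= t <= q -> trajectory x t) -> p <= t0 <= q -> x t0 = 0 ->
  forall t, p <= t <= q -> x t = 0.
Proof.
move=> hp hq xt t0pq x0 t tpq.
have pq : p <= q by lra.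
have [M M0 hM] := entries_bounded hp hq pq.
apply/matrixP => i j; rewrite [j]ord1 [RHS]mxE.
apply: (@linear_ode_unique R n (fun i s => x s i ord0) (fun i s => (A s *m x s) i ord0) M p q t0) => //.
- by move=> k s /xt; exact.
- move=> k s spq; rewrite mxE mulr_sumr; apply: le_trans (ler_norm_sum _ _ _) _.
  by apply: ler_sum => l _; rewrite normrM ler_wpM2r // hM.
- by move=> k; rewrite x0 mxE.
Qed.

Lemma trajectoryB x y t : trajectory x t -> trajectory y t ->
  trajectory (fun s => x s - y s) t.
Proof.
move=> hx hy i; rewrite mulmxBr !mxE.
have -> : (fun s => (x s - y s) i ord0) = (fun s => x s i ord0 - y s i ord0).
  by apply/funext => s; rewrite !mxE.
by have := is_derive_fctB (hx i) (hy i); rewrite !mxE.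
Qed.

Lemma trajectory_unique x y t0 t : I t0 -> I t ->
  (forall s, Num.min t0 t <= s <= Num.max t0 t -> trajectory x s /\ trajectory y s) ->
  x t0 = y t0 -> x t = y t.
Proof.
move=> h0 ht H e; apply/eqP; rewrite -subr_eq0; apply/eqP.
have hm : I (Num.min t0 t) by case: leP.
have hM : I (Num.max t0 t) by case: leP.
apply: (@trajectory_eq0 (fun s => x s - y s) _ _ t0 hm hM).
- by move=> s /H[hx hy]; exact: trajectoryB.
- by rewrite ge_min le_max lexx.
- by rewrite e subrr.
- by rewrite ge_min le_max lexx !orbT.
Qed.

Lemma transition_trajectory Phi t0 (v : 'cV[R]_n) t :
  is_transition_matrix a b A Phi -> I t0 -> I t -> trajectory (fun s => Phi s t0 *m v) t.
Proof.
move=> hPhi h0 ht i; have [_ /(_ t ht)/is_derive_mxP H] := hPhi t0 h0.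
have -> : (fun s => (Phi s t0 *m v) i ord0) = (fun s => \sum_j Phi s t0 i j * v j ord0).
  by apply/funext => s; rewrite mxE.
rewrite mulmxA mxE; apply: is_derive_fct_sum => j.
have := is_derive_fctM (H i j) (is_derive_cst (v j ord0) t 1).
by rewrite mulr0 addr0.
Qed.

Lemma transition_init Phi t0 (v : 'cV[R]_n) : is_transition_matrix a b A Phi -> I t0 ->
  Phi t0 t0 *m v = v.
Proof. by move=> hPhi /hPhi[-> _]; rewrite mul1mx. Qed.

(* The solutions on compact intervals agree where both are defined. *)
Lemma trajectory_exists t0 (v : 'cV[R]_n) : I t0 ->
  exists2 x, x t0 = v & forall t, I t -> trajectory x t.
Proof.
move=> h0.
have seg p q : p <= t0 <= q -> I p -> I q -> exists2 x, x t0 = v &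
    forall t, p <= t <= q -> trajectory x t.
  move=> t0pq hp hq.
  have [|u u0 ud] := @ode_segment R n (fun i j s => A s i j) (fun i => v i ord0) p q t0 t0pq.
    move=> i j t tpq; apply: entry_continuous hA _ _ _ _; exact: ooset_itv hp hq tpq.
  exists (fun t => \col_i u i t).
    by apply/matrixP => i j; rewrite mxE u0 [j]ord1.
  move=> t tpq i; rewrite mxE; under eq_bigr do rewrite mxE.
  have -> : (fun s => (\col_i u i s) i ord0) = u i by apply/funext => s; rewrite mxE.
  exact: ud.
(* For each [t] of [I], a solution on a compact interval that contains [t0] and has [t] in its
   interior; elsewhere a dummy value. *)
have H t : exists pqx : R * R * (R -> 'cV[R]_n), I t ->
   let: (p, q, x) := pqx in
   [/\ I p, p < t, t < q, I q & p <= t0 <= q] /\ x t0 = v /\ forall s, p <= s <= q -> trajectory x s.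
  have [ht|] := pselect (I t); last by move=> ?; exists (0, 0, fun=> 0).
  have [p1 [q1 [hp1 pt1 tq1 hq1]]] := ooset_nbhd ht.
  have hp : I (Num.min p1 t0) by case: leP.
  have hq : I (Num.max q1 t0) by case: leP.
  have t0pq : Num.min p1 t0 <= t0 <= Num.max q1 t0 by rewrite ge_min le_max lexx !orbT.
  have [x x0 xt] := seg _ _ t0pq hp hq.
  exists (Num.min p1 t0, Num.max q1 t0, x) => _; split; last by split.
  by split=> //; [rewrite gt_min pt1 | rewrite lt_max tq1].
have [F hF] := choice H.
have val t s : I t -> I s -> (F t).1.1 <= s <= (F t).1.2 -> (F s).2 s = (F t).2 s.
  move=> ht hs stq.
  have := hF t ht; case: (F t) stq => -[p q] x /= spq [[hp pt tq hq t0pq] [x0 xt]].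
  have := hF s hs; case: (F s) => -[p' q'] y [[hp' pt' tq' hq' t0pq'] [y0 yt]] /=.
  apply: (@trajectory_unique y x t0 s) => //; last by rewrite x0.
  move=> r; rewrite ge_min le_max => /andP[r1 r2]; split; [apply: yt|apply: xt].
    by case/orP: r1; case/orP: r2; lra.
  by case/orP: r1; case/orP: r2; lra.
exists (fun t => (F t).2 t).
  by have := hF t0 h0; case: (F t0) => -[p q] x [_ []].
move=> t ht i.
have := hF t ht; have := val t; case E: (F t) => [[p q] x] /= valt [[hp pt tq hq t0pq] [x0 xt]].
have := xt t; rewrite (ltW pt) (ltW tq) => /(_ isT i).
(* Near [t] the glued function coincides with the single solution [x] chosen for [t]. *)
apply: near_eq_is_derive.
have : nbhs t [set s | p < s < q].
  near=> s; apply/andP; split.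
  - by near: s; exact: lt_nbhsr.
  - by near: s; exact: lt_nbhsl.
apply: filterS => s /= /andP[s1 s2].
have spq : p <= s <= q by rewrite !ltW.
by rewrite valt //; exact: ooset_itv hp hq spq.
Unshelve. all: by end_near. Qed.

Lemma transition_exists : exists Phi, is_transition_matrix a b A Phi.
Proof.
have H (t0j : R * 'I_n) : exists x : R -> 'cV[R]_n, I t0j.1 ->
    x t0j.1 = delta_mx t0j.2 ord0 /\ forall t, I t -> trajectory x t.
  have [h|h] := pselect (I t0j.1); last by exists (fun=> 0).
  by have [x x0 xt] := trajectory_exists (delta_mx t0j.2 ord0) h; exists x.
have [X hX] := choice H.
exists (fun t t0 => \matrix_(i, j) X (t0, j) t i ord0) => t0 h0; split.
  apply/matrixP => i j; rewrite !mxE; have [-> _] := hX (t0, j) h0.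
  by rewrite mxE eqxx andbT.
move=> t ht; apply/is_derive_mxP => i j.
have [_ /(_ t ht i)] := hX (t0, j) h0.
rewrite !mxE; under [in X in _ -> X]eq_bigr do rewrite mxE.
rewrite (_ : (fun s => _ i j) = (fun s => X (t0, j) s i ord0)) //.
by apply/funext => s; rewrite mxE.
Qed.

(** By uniqueness, since both sides agree at [t1]. The time [t] may precede [t1], which is how
    perturbations are carried back. *)
Lemma transition_cocycle Phi x t1 t : is_transition_matrix a b A Phi ->
  (forall t, I t -> trajectory x t) -> I t1 -> I t -> x t = Phi t t1 *m x t1.
Proof.
move=> hPhi hx h1 ht; apply: (@trajectory_unique x (fun s => Phi s t1 *m x t1) t1 t h1 ht).
  have hm : I (Num.min t1 t) by case: leP.
  have hM : I (Num.max t1 t) by case: leP.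
  move=> s /(ooset_itv hm hM) hs; split; first exact: hx.
  exact: transition_trajectory.
by rewrite (transition_init _ hPhi).
Qed.

End Flow.

(** * Variation diminution along the flow *)

Section Norm.
Variables (R : realType) (n : nat).
Implicit Types (x y : 'cV[R]_n) (M : 'M[R]_n).

Definition vnorm x : R := \sum_i `|x i ord0|.

Lemma vnorm_ge0 x : 0 <= vnorm x.
Proof. by apply: sumr_ge0. Qed.

Lemma vnormD x y : vnorm (x + y) <= vnorm x + vnorm y.
Proof.
by rewrite /vnorm -big_split /=; apply: ler_sum => i _; rewrite mxE ler_normD.
Qed.

Lemma vnormZ (c : R) x : vnorm (c *: x) = `|c| * vnorm x.
Proof. by rewrite /vnorm mulr_sumr; apply: eq_bigr => i _; rewrite mxE normrM. Qed.

Lemma vnormN x : vnorm (- x) = vnorm x.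
Proof. by rewrite -scaleN1r vnormZ normrN1 mul1r. Qed.

Lemma vnormB x y : vnorm (x - y) <= vnorm x + vnorm y.
Proof. by rewrite -(vnormN y) vnormD. Qed.

Lemma vnorm_entry x i : `|x i ord0| <= vnorm x.
Proof. by rewrite /vnorm (bigD1 i) //= lerDl sumr_ge0. Qed.

Lemma vnorm_delta x i j : vnorm (delta_mx i j *m x) <= vnorm x.
Proof.
rewrite /vnorm (bigD1 i) //= big1 ?addr0 => [|k ki].
  rewrite mxE (bigD1 j) //= big1 ?addr0 => [|k kj].
    by rewrite mxE !eqxx mul1r vnorm_entry.
  by rewrite mxE (negbTE kj) andbF mul0r.
by rewrite mxE big1 ?normr0 // => l _; rewrite mxE (negbTE ki) mul0r.
Qed.

(** The inverse of one plus the sum of the inverses lies below each [r i], and also makes sense for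
    empty [I]. *)
Lemma finite_min_pos (I : finType) (r : I -> R) : (forall i, 0 < r i) ->
  exists2 d, 0 < d & forall i, d < r i.
Proof.
move=> r0; have S0 : 0 < \sum_i (r i)^-1 + 1.
  by apply: ltr_wpDl => //; apply: sumr_ge0 => i _; rewrite invr_ge0 ltW.
exists (\sum_i (r i)^-1 + 1)^-1; first by rewrite invr_gt0.
move=> i; rewrite invf_plt ?posrE // (bigD1 i) //= -addrA ltrDl.
by apply: ltr_wpDl => //; apply: sumr_ge0 => j _; rewrite invr_ge0 ltW.
Qed.

Lemma nonzero_gap x : exists2 e, 0 < e & forall y, vnorm (x - y) <= e ->
  forall k, x k ord0 != 0 -> 0 < x k ord0 * y k ord0.
Proof.
have [|e e0 he] := @finite_min_pos 'I_n (fun k => if x k ord0 != 0 then `|x k ord0| else 1).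
  by move=> k; case: ifP => // h; rewrite normr_gt0.
exists e => // y xy k hk; have := he k; rewrite hk => ek.
have : `|x k ord0 - y k ord0| < `|x k ord0|.
  apply: le_lt_trans ek; apply: le_trans xy.
  by have := vnorm_entry (x - y) k; rewrite !mxE.
case: (ltrgt0P (x k ord0)) hk => // xk _; rewrite ltr_norml => /andP[h1 h2].
  by rewrite pmulr_rgt0 //; lra.
by rewrite nmulr_rgt0 //; lra.
Qed.

Lemma uniform_radius (I : finType) (P : I -> R -> Prop) :
  (forall i, exists2 r, 0 < r & forall h, `|h| < r -> P i h) ->
  exists2 r, 0 < r & forall h, `|h| < r -> forall i, P i h.
Proof.
move=> H; have H' i : exists r, 0 < r /\ forall h, `|h| < r -> P i h.
  by have [r r0 hr] := H i; exists r.
have [r hr] := choice H'.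
have [|d d0 hd] := finite_min_pos (r := r); first by move=> i; case: (hr i).
exists d => // h hh i; case: (hr i) => _; apply; exact: lt_trans hh (hd i).
Qed.

Definition elementary_product (A : 'M[R]_n) (h : R) (r : seq ('I_n * 'I_n)) : 'M[R]_n :=
  foldr (fun ij B => (1%:M + (h * A ij.1 ij.2) *: delta_mx ij.1 ij.2) *m B) 1%:M r.

(** One factor at a time: a new factor adds its own first-order term, and its action on the
    displacement [P *m x - x] is of second order by the first estimate. This is why both estimates
    are proved together, with [K] independent of [A], [h] and [x]. *)
Lemma elementary_product_bounds (M : R) r : 0 <= M -> exists2 K, 0 <= K &
  forall A : 'M[R]_n, (forall i j, `|A i j| <= M) ->
  forall h x, 0 <= h <= 1 -> let P := elementary_product A h r in
    vnorm (P *m x - x) <= K * h * vnorm x /\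
    vnorm (P *m x - x - h *: ((\sum_(ij <- r) A ij.1 ij.2 *: delta_mx ij.1 ij.2) *m x))
      <= K * h ^+ 2 * vnorm x.
Proof.
move=> M0; elim: r => [|[i j] r [K K0 IH]].
  exists 0 => // A _ h x _ /=.
  rewrite big_nil mul1mx mul0mx scaler0 subr0 subrr /vnorm !mul0r.
  by rewrite big1 // => i _; rewrite mxE normr0.
exists (K + M * (1 + K)); first by rewrite addr_ge0 // mulr_ge0 // addr_ge0.
move=> A hA h x h01 /=; have [h1 h2] := IH A hA h x h01.
set P := elementary_product A h r in h1 h2 *.
rewrite big_cons /= -mulmxA; set y := P *m x in h1 h2 *.
set S := \sum_(ij <- r) _ in h2 *.
rewrite mulmxDl mul1mx -scalemxAl mulmxDl -scalemxAl scalerDr scalerA.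
set a := h * A i j; pose E : 'M[R]_n := delta_mx i j; rewrite -/E.
have h0 : 0 <= h by case/andP: h01.
have ah : `|a| <= h * M by rewrite /a normrM ger0_norm // ler_wpM2l.
have X0 := vnorm_ge0 x.
have ny : vnorm y <= (1 + K * h) * vnorm x.
  rewrite -[y](subrK x) mulrDl mul1r addrC; apply: le_trans (vnormD _ _) _; lra.
have hh : h ^+ 2 <= h by rewrite expr2 ler_piMr //; case/andP: h01.
have nE z c : vnorm z <= c -> vnorm (a *: (E *m z)) <= h * M * c.
  move=> zc; rewrite vnormZ ler_pM ?vnorm_ge0 //.
  exact: le_trans (vnorm_delta _ _ _) zc.
split.
  have -> : y + a *: (E *m y) - x = (y - x) + a *: (E *m y) by rewrite addrAC.
  apply: le_trans (vnormD _ _) _; apply: le_trans (lerD h1 (nE _ _ ny)) _.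
  have : h * M * ((1 + K * h) * vnorm x) <= h * M * ((1 + K) * vnorm x).
    rewrite ler_wpM2l ?mulr_ge0 // ler_wpM2r // lerD2l ler_piMr //; by case/andP: h01.
  nra.
have -> : y + a *: (E *m y) - x - (a *: (E *m x) + h *: (S *m x)) =
   (y - x - h *: (S *m x)) + a *: (E *m (y - x)).
  by rewrite mulmxBr scalerBr; apply/matrixP => k l; rewrite !mxE; ring.
apply: le_trans (vnormD _ _) _; apply: le_trans (lerD h2 (nE _ _ h1)) _.
have -> : K * h ^+ 2 * vnorm x + h * M * (K * h * vnorm x) = (K + M * K) * h ^+ 2 * vnorm x by ring.
by rewrite ler_wpM2r // ler_wpM2r ?exprn_ge0 // lerD2l ler_wpM2l // lerDr.
Qed.

Lemma sum_elementary (A : 'M[R]_n) :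
  \sum_(ij <- index_enum ('I_n * 'I_n)%type) A ij.1 ij.2 *: delta_mx ij.1 ij.2 = A.
Proof. by rewrite [RHS]matrix_sum_delta pair_bigA. Qed.

(** A diagonal factor scales one entry by a positive number, an off-diagonal one with nonzero
    coefficient adds a nonnegative multiple of a neighbour, and the remaining factors are
    identities. *)
Lemma sc_minus_elementary_product (A : 'M[R]_n) h r x :
  cyclic_tridiagonal_metzler A -> 0 <= h -> (forall i, h * `|A i i| < 1) ->
  (sc_minus (elementary_product A h r *m x) <= sc_minus x)%N.
Proof.
move=> [mA bA] h0 hA; elim: r => [|[i j] r IH] /=; first by rewrite mul1mx.
rewrite -mulmxA; apply: leq_trans IH; move: (_ *m x) => y.
set z := _ *m y.
have zE k : z k ord0 = y k ord0 + (k == i)%:R * (h * A i j * y j ord0).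
  rewrite /z mulmxDl mul1mx -scalemxAl !mxE (bigD1 j) //= big1 ?addr0.
    rewrite mxE eqxx andbT; congr (_ + _); ring.
  by move=> l lj; rewrite mxE (negbTE lj) andbF mul0r.
have [ij|ji] := eqVneq j i.
  apply: sc_minus_same_signs => k; rewrite zE; have [->|_] := eqVneq k i; last first.
    by rewrite mul0r addr0 -expr2 exprn_even_gt0.
  rewrite mul1r ij => zi.
  have a0 : 0 < 1 + h * A i i.
    have := hA i; rewrite -[h in X in X -> _]ger0_norm // -normrM ltr_norml => /andP[h1 _]; lra.
  have -> : (y i ord0 + h * A i i * y i ord0) * y i ord0 = (1 + h * A i i) * y i ord0 ^+ 2 by ring.
  rewrite mulr_gt0 // exprn_even_gt0 //=; apply: contra zi => /eqP ->.
  by rewrite mulr0 addr0.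
have [a0|a0] := eqVneq (A i j) 0.
  suff -> : z = y by [].
  by apply/matrixP => k l; rewrite [l]ord1 zE a0 mulr0 mul0r mulr0 addr0.
apply: (@sc_minus_add_neighbour _ _ y z i j (h * A i j)) => //.
  by rewrite mulr_ge0 // mA // eq_sym.
exact: (neighbours_of_cyclic_tridiagonal (conj mA bA) ji a0).
Qed.

End Norm.

(** * Solutions do not increase the lower cyclic count *)

Section WeakVariationDiminishing.
Variables (R : realType) (n : nat) (a b : \bar R) (A : R -> 'M[R]_n).
Hypothesis hA : {within ooset a b, continuous A}.
Local Notation I := (ooset a b).

Lemma trajectory_eps x t : trajectory A x t -> forall e, 0 < e ->
  exists2 r, 0 < r & forall h, `|h| < r ->
    vnorm (x (t + h) - x t - h *: (A t *m x t)) <= e * `|h|.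
Proof.
move=> xt e e0.
have e' : 0 < e / (n%:R + 1) by rewrite divr_gt0 // ltr_wpDl.
have [r r0 hr] := uniform_radius (fun i => is_derive_eps (xt i) e').
exists r => // h /hr H; rewrite /vnorm.
apply: (@le_trans _ _ (\sum_(i < n) e / (n%:R + 1) * `|h|)).
  by apply: ler_sum => i _; have := H i; rewrite !mxE.
rewrite sumr_const card_ord -[leLHS]mulr_natl mulrA ler_wpM2r //.
rewrite mulrCA ler_piMr ?(ltW e0) // ler_pdivrMr ?mul1r ?lerDl //.
Qed.

Lemma trajectory_continuous x t : trajectory A x t -> forall e, 0 < e ->
  exists2 r, 0 < r & forall s, `|s - t| < r -> vnorm (x s - x t) < e.
Proof.
move=> xt e e0.
have e' : 0 < e / (n%:R + 1) by rewrite divr_gt0 // ltr_wpDl.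
have [i|r r0 hr] := @uniform_radius R 'I_n
    (fun i s => `|x (t + s) i ord0 - x t i ord0| < e / (n%:R + 1)).
  have [r r0 H] := continuous_eps (is_derive_continuous (xt i)) e'.
  by exists r => // h hh; apply: H; rewrite addrC addKr.
exists r => // s /hr H; rewrite /vnorm.
apply: (@le_lt_trans _ _ (\sum_(i < n) e / (n%:R + 1))).
  by apply: ler_sum => i _; have := H i; rewrite (addrC t) subrK !mxE => /ltW.
rewrite sumr_const card_ord -[ltLHS]mulr_natl mulrCA.
rewrite gtr_pMr // ltr_pdivrMr ?mul1r ?ltrDl //; exact: ltr_wpDl.
Qed.

(** Sublevel sets of $s_c^-$ are closed: a close enough [y] keeps the signs of the nonzero entries
    of [x]. *)
Lemma sc_minus_close (N : nat) (x : 'cV[R]_n) :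
  (forall e, 0 < e -> exists2 y, (sc_minus y <= N)%N & vnorm (x - y) <= e) ->
  (sc_minus x <= N)%N.
Proof.
have [e e0 he] := nonzero_gap x; move=> /(_ e e0)[y hy /he xy].
by apply: leq_trans hy; exact: sc_minus_same_signs.
Qed.

(* [T] is the supremum of the times [t] at which [x t] is within [e * w t] of the
   closed set [sc_minus <= N]; an elementary product applied at [T] to
   a nearby point of this set extends the estimate beyond [T]. *)
Lemma sc_minus_trajectory x t0 t1 :
  (forall s, I s -> cyclic_tridiagonal_metzler (A s)) ->
  (forall s, I s -> trajectory A x s) -> I t0 -> I t1 -> t0 <= t1 ->
  (sc_minus (x t1) <= sc_minus (x t0))%N.
Proof.
move=> hQ hx h0 h1 t01.
have [M M0 hM] := entries_bounded hA h0 h1 t01.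
pose r := index_enum ('I_n * 'I_n)%type.
have [K K0 hK] := @elementary_product_bounds R n M r M0.
(* In [L], the [K] pays for the action of the product on [x T - y], one unit for the two errors of
   size [h * (c / 2)], and one unit for [eta]. *)
set N := sc_minus (x t0); pose L := K + 2.
apply: sc_minus_close => e0 e00.
pose w t := expR (L * (t - t0)).
have w0 t : 0 < w t by exact: expR_gt0.
have L0 : 0 <= L by rewrite /L; lra.
have wS t h : w t * (1 + L * h) <= w (t + h).
  have -> : w (t + h) = w t * expR (L * h) by rewrite /w -expRD; congr expR; ring.
  by rewrite ler_wpM2l ?(ltW (w0 t)) // expR_ge1Dx.
have wm s t : s <= t -> w s <= w t.
  by move=> st; rewrite /w ler_expR ler_wpM2l // lerD2r.
clearbody w.
(* At [t1] the tolerance [e * w t1] is [e0 / 2], which leaves [e0 / 2] for the defect of the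
   supremum. *)
pose e := e0 / (2 * w t1).
have e_gt0 : 0 < e by rewrite divr_gt0 // mulr_gt0.
pose G := [set t | t0 <= t <= t1 /\
  exists2 y, (sc_minus y <= N)%N & vnorm (x t - y) <= e * w t].
have G0 : G t0.
  split; first by rewrite lexx.
  exists (x t0) => //; rewrite subrr -(scale0r (x t0)) vnormZ normr0 mul0r.
  by rewrite mulr_ge0 // ltW.
have hs : has_sup G by split; [exists t0 | exists t1 => t [/andP[]]].
pose T := sup G.
have T0 : t0 <= T by exact: sup_upper_bound.
have T1 : T <= t1 by apply: ge_sup; [exists t0 | move=> t [/andP[]]].
have IT : I T by apply: (ooset_itv h0 h1); rewrite T0.
(* Approximating the supremum by points of [G] gives the estimate at [T] up to an arbitrary
   [eta]. *)
have near_T eta : 0 < eta -> exists2 y, (sc_minus y <= N)%N & vnorm (x T - y) <= e * w T + eta.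
  move=> eta0; have [d d0 hd] := trajectory_continuous (hx T IT) eta0.
  have [s [st [y yN xy]] sT] := sup_adherent d0 hs.
  have sT' : s <= T by apply: sup_upper_bound => //; split => //; exists y.
  exists y => //; have -> : x T - y = (x s - y) - (x s - x T).
    by apply/matrixP => i j; rewrite !mxE; ring.
  apply: le_trans (vnormB _ _) _; apply: lerD.
    by apply: le_trans xy _; rewrite ler_wpM2l ?(ltW e_gt0) // wm.
  apply/ltW/hd; rewrite ltr_norml; rewrite -/T in sT; lra.
have [T_lt|T_ge] := ltP T t1; last first.
  have ET : T = t1 by apply/le_anti; rewrite T1.
  have [|y yN xy] := near_T (e0 / 2); first by lra.
  exists y => //; move: xy; rewrite ET; move/le_trans; apply.
  have -> : e * w t1 = e0 / 2 by rewrite /e; field; exact: lt0r_neq0.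
  lra.
exfalso.
pose c := e * w T; have c0 : 0 < c by rewrite mulr_gt0.
have c2 : 0 < c / 2 by lra.
have [d d0 hd] := trajectory_eps (hx T IT) c2.
have X0 := vnorm_ge0 (x T).
have KX0 : 0 <= K * vnorm (x T) by rewrite mulr_ge0.
(* The bounds on [h] serve, in order: the expansion of [x] at [T], the estimates for the product,
   staying before [t1], a second-order term of at most [h * (c / 2)], and positivity of the diagonal
   factors. *)
pose rr (i : 'I_5) : R := [:: d; 1; t1 - T; c / 2 / (K * vnorm (x T) + 1); (M + 1)^-1]`_i.
have rr0 i : 0 < rr i.
  have h3 : 0 < c / 2 / (K * vnorm (x T) + 1) by rewrite divr_gt0 // ltr_wpDl.
  have h4 : 0 < (M + 1)^-1 by rewrite invr_gt0 ltr_wpDl.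
  by case: i => [[|[|[|[|[|//]]]]]] ? //=; rewrite subr_gt0.
have [h h_gt0 hh] := finite_min_pos rr0.
have hd' : h < d := hh (@Ordinal 5 0 isT).
have h_1 : h < 1 := hh (@Ordinal 5 1 isT).
have hT : h < t1 - T := hh (@Ordinal 5 2 isT).
have hX : h < c / 2 / (K * vnorm (x T) + 1) := hh (@Ordinal 5 3 isT).
have hM' : h < (M + 1)^-1 := hh (@Ordinal 5 4 isT).
clear hh rr0 rr.
have K10 : 0 < 1 + K by lra.
(* With this choice [eta + K * h * eta] is at most [h * c]. *)
pose eta := h * c / (1 + K).
have eta0 : 0 < eta by rewrite divr_gt0 // mulr_gt0.
have [y yN xy] := near_T eta eta0.
have AT : forall i j, `|A T i j| <= M by move=> i j; apply: hM; rewrite T0.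
have h01 : 0 <= h <= 1 by rewrite !ltW.
pose P := elementary_product (A T) h r.
have PN : (sc_minus (P *m y) <= N)%N.
  apply: leq_trans yN; apply: sc_minus_elementary_product => //.
  - exact: hQ.
  - exact: ltW.
  - move=> i; have M1 : 0 < M + 1 by lra.
    apply: (@le_lt_trans _ _ (h * M)); first by rewrite ler_wpM2l ?(ltW h_gt0).
    by move: hM'; rewrite -[(M + 1)^-1]mul1r ltr_pdivlMr //; lra.
suff : G (T + h).
  move=> /(sup_upper_bound hs); rewrite -/T; lra.
split; first by lra.
exists (P *m y) => //.
have [_] := hK (A T) AT h (x T) h01; rewrite sum_elementary -/P => p2.
have [p1 _] := hK (A T) AT h (x T - y) h01; rewrite -/P in p1.
have p3 := hd h; rewrite (gtr0_norm h_gt0) in p3; have {}p3 := p3 hd'.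
(* The error splits into the remainder of the flow, the remainder of the product, the displacement
   of [x T - y] by the product, and [x T - y] itself. *)
have -> : x (T + h) - P *m y = (x (T + h) - x T - h *: (A T *m x T))
  - (P *m x T - x T - h *: (A T *m x T)) + ((P *m (x T - y) - (x T - y)) + (x T - y)).
  rewrite mulmxBr; apply/matrixP => i j.
  rewrite !(mxE, opprB); do ?[move: ((_ *m _) _ _) => ?]; ring.
apply: le_trans (vnormD _ _) _.
have q1 := le_trans (vnormB _ _) (lerD p3 p2).
have q2 := le_trans (vnormD _ _) (lerD p1 xy).
apply: le_trans (lerD q1 q2) _; clear q1 q2 p1 p2 p3.
have q3 : K * h * vnorm (x T - y) <= K * h * (c + eta) by rewrite ler_wpM2l ?mulr_ge0 ?(ltW h_gt0).
have q4 : K * h ^+ 2 * vnorm (x T) <= h * (c / 2).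
  have -> : K * h ^+ 2 * vnorm (x T) = h * (h * (K * vnorm (x T))) by ring.
  rewrite ler_wpM2l ?(ltW h_gt0) //.
  by move: hX; rewrite ltr_pdivlMr; last lra; nra.
have q5 : eta + K * h * eta <= h * c.
  have e1 : eta * (1 + K) = h * c by rewrite /eta divfK // lt0r_neq0.
  have : K * h * eta <= K * eta by rewrite ler_wpM2r ?(ltW eta0) // ler_piMr // ltW.
  lra.
have q6 : c * (1 + L * h) <= e * w (T + h).
  by rewrite /c -mulrA ler_wpM2l ?(ltW e_gt0).
apply: le_trans q6; rewrite -/c /L.
have -> : c * (1 + (K + 2) * h) = c + K * h * c + 2 * (h * c) by ring.
have -> : c / 2 * h = h * c / 2 by ring.
rewrite mulrDr in q3; rewrite mulrA in q4; lra.
Qed.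

End WeakVariationDiminishing.

(** * From the lower to the upper cyclic count *)

Section StrongVariationDiminishing.
Variables (R : realType) (n : nat) (a b : \bar R) (A : R -> 'M[R]_n).
Hypothesis hA : {within ooset a b, continuous A}.
Local Notation I := (ooset a b).

(** When the two neighbours of [i] have the same weak sign, row [i] of [B *m v] is a sum of terms of
    one sign; as it vanishes, so does each term. *)
Lemma balance_vanishing (B : 'M[R]_n) (v : 'cV[R]_n) i j :
  cyclic_tridiagonal_metzler B -> (B *m v) i ord0 = 0 -> v i ord0 = 0 ->
  0 <= v (prev i) ord0 * v (next i) ord0 -> j != i -> B i j != 0 -> v j ord0 = 0.
Proof.
move=> hB Bv vi vv ji Bij.
have pos (u : 'cV[R]_n) : (B *m u) i ord0 = 0 -> u i ord0 = 0 ->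
    0 <= u (prev i) ord0 -> 0 <= u (next i) ord0 -> u j ord0 = 0.
  rewrite mxE => /eqP + ui up un; rewrite psumr_eq0 => [/allP/(_ j)|k _].
    by rewrite mem_index_enum mulf_eq0 (negbTE Bij) => /(_ isT)/eqP.
  have [->|ki] := eqVneq k i; first by rewrite ui mulr0.
  have [->|Bik] := eqVneq (B i k) 0; first by rewrite mul0r.
  rewrite mulr_ge0 //; first by apply: hB.1; rewrite eq_sym.
  by case/orP: (neighbours_of_cyclic_tridiagonal hB ki Bik) => /eqP ->.
have neg : v (prev i) ord0 <= 0 -> v (next i) ord0 <= 0 -> v j ord0 = 0.
  move=> up un; apply/eqP; rewrite -oppr_eq0; apply/eqP.
  have := pos (- v); rewrite mulmxN !mxE => ->//; rewrite ?oppr_ge0 //.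
  - by move: Bv; rewrite mxE => ->; rewrite oppr0.
  - by rewrite vi oppr0.
have [p|p|p] := ltrgt0P (v (prev i) ord0).
- by apply: pos => //; [exact: ltW | rewrite pmulr_rge0 in vv].
- by apply: neg; [exact: ltW | rewrite nmulr_rge0 in vv].
- have [q|q] := leP 0 (v (next i) ord0); first by apply: pos => //; rewrite p.
  by apply: neg; [rewrite p | exact: ltW].
Qed.

(* The zeros whose neighbours do not have opposite signs form a set that no edge
   leaves. *)
Lemma regular_of_balance (B : 'M[R]_n) (v : 'cV[R]_n) :
  cyclic_tridiagonal_metzler B -> irreducible_mx B -> v != 0 ->
  (forall i, v i ord0 = 0 -> (B *m v) i ord0 = 0) -> regular v.
Proof.
move=> hB irr v0 hv i vi; rewrite ltNge; apply/negP => vv; case/negP: v0.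
pose W k := v k ord0 = 0 /\ 0 <= v (prev k) ord0 * v (next k) ord0.
have W_closed k l : W k -> k != l -> B k l != 0 -> W l.
  move=> [vk vvk] kl Bkl; have lk : l != k by rewrite eq_sym.
  split; first exact: balance_vanishing hB (hv k vk) vk vvk lk Bkl.
  have := neighbours_of_cyclic_tridiagonal hB lk Bkl.
  (* The index [k], where [v] vanishes, is one of the two neighbours of [l], so the product at [l]
     is zero. *)
  by case/orP => /eqP ->; rewrite ?ordSK ?ord_predK vk ?mul0r ?mulr0.
have Wall k : W k.
  have /connectP[s] := irr i k; have : W i by [].
  elim: s i {vi vv} => [|l s IH] i Wi /=; first by move=> _ ->.
  case/andP=> /andP[il Bil] ps e; apply: (IH l) => //.
  exact: W_closed Wi il Bil.
by apply/eqP/matrixP => k l; rewrite [l]ord1 [RHS]mxE; case: (Wall k).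
Qed.

Lemma regular_time x t0 t1 : I t0 -> I t1 -> t0 < t1 ->
  (forall s, I s -> cyclic_tridiagonal_metzler (A s)) ->
  (forall p q, I p -> I q -> p < q -> exists2 t, p <= t <= q & irreducible_mx (A t)) ->
  (forall s, I s -> trajectory A x s) -> x t0 != 0 ->
  exists2 t, t0 <= t <= t1 & regular (x t).
Proof.
move=> h0 h1 t01 hQ hirr hx x0.
have I01 s : t0 <= s <= t1 -> I s by exact: ooset_itv.
have [||p [q [tp pq qt hpq]]] := @shrink_interval R 'I_n (fun i s => x s i ord0) t0 t1.
- by [].
- by move=> i s /I01/hx/(_ i)/is_derive_continuous.
(* The middle third keeps [t] interior to [[p, q]], so a coordinate that vanishes on [[p, q]] has
   zero derivative at [t]. *)
pose p' := (2 * p + q) / 3; pose q' := (p + 2 * q) / 3.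
have [h2 h3] : p < p' /\ q' < q by rewrite /p' /q'; split; lra.
have h4 : p' < q' by rewrite /p' /q'; lra.
have [||t tpq irr] := hirr p' q' _ _ h4; try by apply: I01; lra.
have It : I t by apply: I01; lra.
exists t; first by lra.
apply: regular_of_balance (hQ t It) irr _ _.
  (* A solution that vanishes at [t] vanishes at [t0] as well. *)
  apply: contraNneq x0 => xt; apply/eqP.
  apply: (@trajectory_eq0 R n a b A hA x t0 t1 t) => //; try lra.
  by move=> s /I01; exact: hx.
move=> i xi; case: (hpq i) => [z|nz]; last first.
  by have := nz t; rewrite xi eqxx => H; exfalso; apply: notF; apply: H; lra.
have d0 : is_derive t 1 (fun s => x s i ord0) 0.
  apply: near_eq_is_derive _ (is_derive_cst (0 : R) t 1).
  near=> s; rewrite z //; apply/andP; split; apply: ltW.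
  - by near: s; apply: lt_nbhsr; lra.
  - by near: s; apply: lt_nbhsl; lra.
by case: (hx t It i) => _ <-; case: d0.
Unshelve. all: by end_near. Qed.

Lemma transition_SCVDP Phi t0 t1 : (0 < n)%N ->
  (forall s, I s -> cyclic_tridiagonal_metzler (A s)) ->
  (forall p q, I p -> I q -> p < q -> exists2 t, p <= t <= q & irreducible_mx (A t)) ->
  is_transition_matrix a b A Phi -> I t0 -> I t1 -> t0 < t1 -> SCVDP (Phi t1 t0).
Proof.
move=> hn hQ hirr hPhi h0 h1 t01 v v0.
pose x t := Phi t t0 *m v.
have hx s : I s -> trajectory A x s by exact: transition_trajectory hPhi h0.
have x0 : x t0 = v by exact: (transition_init _ hPhi h0).
have [|t /andP[t0t tt1] rt] := regular_time h0 h1 t01 hQ hirr hx; first by rewrite x0.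
have It : I t by apply: (ooset_itv h0 h1); rewrite t0t.
have [s hs] := sc_plus_perturb (x t1) hn.
have [e e0 he] := nonzero_gap (x t).
pose w := Phi t t1 *m s; have w0 := vnorm_ge0 w.
(* The perturbation [s] at [t1] becomes [w] at [t]; this [d] keeps [d *: w] within the gap [e]
   around [x t]. *)
pose d := e / (vnorm w + 1).
have d0 : 0 < d by rewrite divr_gt0 // ltr_wpDl.
pose y r := Phi r t1 *m (x t1 + d *: s).
have hy r : I r -> trajectory A y r by exact: transition_trajectory hPhi h1.
have yt : y t = x t + d *: w.
  by rewrite /y mulmxDr -scalemxAr -(transition_cocycle hA hPhi hx h1 It).
have y1 : y t1 = x t1 + d *: s by exact: (transition_init _ hPhi h1).
have yx : (sc_minus (y t) <= sc_minus (x t))%N.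
  apply: regular_sc_minus rt _; apply: he.
  rewrite yt opprD addNKr vnormN vnormZ gtr0_norm // /d mulrAC -mulrA.
  by rewrite ler_piMr ?(ltW e0) // ler_pdivrMr ?mul1r ?lerDl // ltr_wpDl.
(* The chain runs from [sc_plus (x t1)] through [sc_minus] of [y t1], [y t] and [x t] to
   [sc_minus (x t0)]. *)
rewrite -/(x t1); apply: leq_trans (hs d d0) _; rewrite -y1.
apply: leq_trans (sc_minus_trajectory hA hQ hy It h1 tt1) _.
apply: leq_trans yx _; rewrite -x0.
exact: (sc_minus_trajectory hA hQ hx h0 It t0t).
Qed.

End StrongVariationDiminishing.

(** * Necessity *)

Section Necessity.
Variables (R : realType) (n : nat) (a b : \bar R) (A : R -> 'M[R]_n).
Hypothesis hA : {within ooset a b, continuous A}.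
Local Notation I := (ooset a b).
Variable Phi : R -> R -> 'M[R]_n.
Hypothesis hPhi : is_transition_matrix a b A Phi.
Hypothesis hV : forall t0 t, I t0 -> I t -> t0 < t -> SCVDP (Phi t t0).

Definition right_near (P : R -> Prop) := exists2 r : R, 0 < r & forall h, 0 < h < r -> P h.

Lemma right_near_and P Q : right_near P -> right_near Q -> right_near (fun h => P h /\ Q h).
Proof.
move=> [r r0 hr] [s s0 hs]; exists (Num.min r s); first by rewrite lt_min r0.
by move=> h; rewrite lt_min => /and3P[h0 h1 h2]; split; [apply: hr|apply: hs]; rewrite h0.
Qed.

Lemma right_near_ex P : right_near P -> exists2 h : R, 0 < h & P h.
Proof. by move=> [r r0 hr]; exists (r / 2); [lra | apply: hr; lra]. Qed.

Lemma right_near_ooset t : I t -> right_near (fun h => I (t + h)).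
Proof.
move=> /[dup] It /ooset_nbhd[p [q [hp pt tq hq]]].
by exists (q - t); [lra | move=> h hh; apply: (ooset_itv It hq); lra].
Qed.

Lemma right_near_pos t (v : 'cV[R]_n) i : I t ->
  0 < v i ord0 \/ v i ord0 = 0 /\ 0 < (A t *m v) i ord0 ->
  right_near (fun h => 0 < (Phi (t + h) t *m v) i ord0).
Proof.
move=> It H.
have hx : trajectory A (fun s => Phi s t *m v) t by exact: (transition_trajectory _ hPhi It It).
have E h e : vnorm (Phi (t + h) t *m v - Phi t t *m v - h *: (A t *m (Phi t t *m v))) <= e ->
    v i ord0 + h * (A t *m v) i ord0 - e <= (Phi (t + h) t *m v) i ord0.
  rewrite (transition_init _ hPhi It) => H'.
  have := le_trans (vnorm_entry _ i) H'; rewrite [X in `|X|]mxE [X in `|X + _|]mxE.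
  rewrite [X in `|_ + X|]mxE [X in `|_ - X|]mxE [X in `|_ + X - _|]mxE ler_norml => /andP[]; lra.
set c := (A t *m v) i ord0 in H E.
case: H => [v0|[v0 c0]].
  have [r r0 hr] := trajectory_eps hx ltr01.
  have c1 : 0 < `|c| + 1 by rewrite ltr_wpDl.
  have q0 : 0 < v i ord0 / (`|c| + 1) by rewrite divr_gt0.
  exists (Num.min r (v i ord0 / (`|c| + 1))); first by rewrite lt_min r0.
  move=> h; rewrite lt_min => /and3P[h0 hr' hv'].
  have := hr h; rewrite gtr0_norm // => /(_ hr')/E; apply: lt_le_trans.
  rewrite ltr_pdivlMr // in hv'; have := ler_norm (- c); rewrite normrN => h1.
  nra.
have c2 : 0 < c / 2 by lra.
have [r r0 hr] := trajectory_eps hx c2.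
exists r => // h /andP[h0 hr'].
have := hr h; rewrite gtr0_norm // => /(_ hr')/E; apply: lt_le_trans.
rewrite v0; nra.
Qed.

Lemma right_near_neg t (v : 'cV[R]_n) i : I t ->
  v i ord0 < 0 \/ v i ord0 = 0 /\ (A t *m v) i ord0 < 0 ->
  right_near (fun h => (Phi (t + h) t *m v) i ord0 < 0).
Proof.
move=> It H; have [|r r0 hr] := @right_near_pos t (- v) i It.
  rewrite mulmxN [(- v) i ord0]mxE [(- (A t *m v)) i ord0]mxE.
  by case: H => [h|[-> h]]; [left | right]; rewrite oppr_gt0 // oppr0.
by exists r => // h /hr; rewrite mulmxN mxE oppr_gt0.
Qed.

(** Column [j] is the image of a unit vector, whose $s_c^-$ is zero; its $s_c^+$ is then zero, which
    excludes zero entries and opposite signs. *)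
Lemma transition_column_pos t0 t i j : I t0 -> I t -> t0 < t -> i != j ->
  0 < Phi t t0 i j * Phi t t0 j j.
Proof.
move=> h0 ht t0t ij; rewrite ltNge; apply/negP => H.
pose e : 'cV[R]_n := delta_mx j ord0.
have Pe k : (Phi t t0 *m e) k ord0 = Phi t t0 k j by rewrite -colE mxE.
have e_neq0 : e != 0.
  by apply/eqP => /matrixP/(_ j ord0); rewrite !mxE !eqxx => /eqP; rewrite oner_eq0.
have := hV h0 ht t0t e_neq0; rewrite (sc_minus_ge0 (x := e)).
  by rewrite leqNgt (@sc_plus_gt0 _ _ _ i j ij) // !Pe.
by move=> k; rewrite mxE; case: (_ && _).
Qed.

(** A negative [A t i j] would make entry [(i, j)] of the transition matrix negative just after [t],
    while [(j, j)] is still positive. *)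
Lemma necessary_metzler t : I t -> metzler (A t).
Proof.
move=> It i j ij; rewrite leNgt; apply/negP => Aij.
pose e : 'cV[R]_n := delta_mx j ord0.
have Pe M k : (M *m e) k ord0 = M k j by rewrite -colE mxE.
have [||h h0 [Ih [h1 h2]]] := right_near_ex (right_near_and (right_near_ooset It)
  (right_near_and (@right_near_pos t e j It _) (@right_near_neg t e i It _))).
- by left; rewrite mxE !eqxx.
- by right; rewrite mxE (negbTE ij) Pe.
rewrite !Pe in h1 h2; have tth : t < t + h by lra.
have := transition_column_pos It Ih tth ij.
by rewrite nmulr_rgt0 // ltNge (ltW h1).
Qed.

(** The vector [v] is positive at [j], $-1$ at the neighbours of [j] and zero elsewhere. Just after
    [t] those signs persist and [i] becomes positive: the upper count exceeds two. *)
Lemma necessary_band t i j : I t -> A t i j != 0 -> i != j -> neighbours i j.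
Proof.
move=> It Aij0 ij; apply: contraT => nij.
have Aij : 0 < A t i j by rewrite lt_neqAle eq_sym Aij0 necessary_metzler.
pose S := \sum_k `|A t i k|.
have S0 : 0 <= S by apply: sumr_ge0.
(* Then [A t i j * c] is [A t i j + S], which outweighs all other terms of row [i]. *)
pose c := 1 + S / A t i j.
have c0 : 0 < c by rewrite ltr_wpDr // divr_ge0 // ltW.
pose v : 'cV[R]_n := \col_k if k == j then c else - (neighbours j k)%:R.
have pj : prev j != j by rewrite (@prev_neq _ j i) // eq_sym.
have nj := next_prev_neq pj.
have vj : v j ord0 = c by rewrite mxE eqxx.
have vn : v (next j) ord0 = -1 by rewrite mxE (negbTE nj) /neighbours eqxx.
have vp : v (prev j) ord0 = -1 by rewrite mxE (negbTE pj) /neighbours eqxx orbT.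
rewrite neighbours_sym in nij.
have vi : v i ord0 = 0 by rewrite mxE (negbTE ij) (negbTE nij) oppr0.
have v_neq0 : v != 0.
  by apply/eqP => /matrixP/(_ j ord0); rewrite vj mxE => /eqP; rewrite gt_eqF.
have Av : 0 < (A t *m v) i ord0.
  rewrite mxE (bigD1 j) //= vj.
  have Sj : S = A t i j + \sum_(k | k != j) `|A t i k|.
    by rewrite /S (bigD1 j) //= gtr0_norm.
  have : - \sum_(k | k != j) `|A t i k| <= \sum_(k | k != j) A t i k * v k ord0.
    rewrite -sumrN; apply: ler_sum => k kj; rewrite mxE (negbTE kj).
    have := ler_norm (A t i k); have := normr_ge0 (A t i k).
    by case: (neighbours j k); rewrite ?mulrN1 ?oppr0 ?mulr0; lra.
  have -> : A t i j * c = A t i j + S by rewrite /c; field.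
  lra.
have [||||h h0 [Ih [h1 [h2 [h3 h4]]]]] := right_near_ex (right_near_and (right_near_ooset It)
  (right_near_and (@right_near_pos t v i It _) (right_near_and (@right_near_pos t v j It _)
  (right_near_and (@right_near_neg t v (next j) It _) (@right_near_neg t v (prev j) It _))))).
- by right.
- by left; rewrite vj.
- by left; rewrite vn ltrN10.
- by left; rewrite vp ltrN10.
have tth : t < t + h by lra.
have := hV It Ih tth v_neq0; rewrite leqNgt => /negP[].
apply: leq_ltn_trans (sc_minus_peak (j := j) _) _.
  by move=> k kj; rewrite mxE (negbTE kj) oppr_le0.
move: nij; rewrite /neighbours negb_or => /andP[nij1 nij2].
exact: sc_plus_two_peaks ij nij1 nij2 h1 h2 h3 h4.
Qed.

(** The set [S] of indices reachable from [i] misses [j], and rows in [S] involve only columns in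
    [S]. A solution starting from the unit vector at [j] stays zero on [S], so entry [(i, j)]
    vanishes. *)
Lemma necessary_irreducible p q : I p -> I q -> p < q ->
  exists2 t, p <= t <= q & irreducible_mx (A t).
Proof.
move=> hp hq pq; apply: contrapT => H.
have [||p' [q' [pp' pq' qq' hz]]] :=
  @shrink_interval R ('I_n * 'I_n)%type (fun ij s => A s ij.1 ij.2) p q.
- by [].
- by move=> ij s spq; apply: (entry_continuous hA); exact: ooset_itv hp hq spq.
have hp' : I p' by apply: (ooset_itv hp hq); lra.
have hq' : I q' by apply: (ooset_itv hp hq); lra.
have /existsNP[i /existsNP[j nij]] : ~ irreducible_mx (A p').
  by move=> irr; apply: H; exists p' => //; lra.
set E := [rel k l | _] in nij; pose S k := connect E i k.
have Si : S i by exact: connect0.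
have ij : i != j by apply: contra_notN nij => /eqP <-; exact: connect0.
(* Each entry of [A] is identically zero or nowhere zero on [[p', q']], so the pattern at [p'] holds
   throughout. *)
have zero k l s : S k -> ~~ S l -> p' <= s <= q' -> A s k l = 0.
  move=> Sk Sl spq; case: (hz (k, l)) => [/(_ s spq)//|/(_ p')] /= Akl.
  case/negP: (Sl); apply: (connect_trans Sk (connect1 _)); rewrite /E /= Akl; last lra.
  by rewrite andbT; apply: contraNneq Sl => <-.
pose y s := Phi s p' *m (delta_mx j ord0 : 'cV[R]_n).
have pq'' : p' <= q' by exact: ltW.
have [M M0 hM] := entries_bounded hA hp' hq' pq''.
(* Coordinates outside [S] are masked by zero, which leaves a closed linear system on [S] with zero
   initial value. *)
have y0 : (if S i then y q' i ord0 else 0) = 0.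
  apply: (@linear_ode_unique R n (fun k s => if S k then y s k ord0 else 0)
    (fun k s => if S k then (A s *m y s) k ord0 else 0) M p' q' p') => //.
  - move=> k s spq; case: (S k); last exact: is_derive_cst.
    have Is : I s by apply: (ooset_itv hp' hq').
    exact: (transition_trajectory _ hPhi hp' Is).
  - move=> k s spq; case Sk: (S k); last first.
      by rewrite normr0 mulr_ge0 // sumr_ge0.
    rewrite mxE mulr_sumr; apply: le_trans (ler_norm_sum _ _ _) _.
    apply: ler_sum => l _; case Sl: (S l).
      by rewrite normrM ler_wpM2r // hM.
    by rewrite (zero k l s) ?Sl // mul0r normr0 mulr0.
  - by rewrite lexx.
  - move=> k; case Sk: (S k) => //; rewrite /y (transition_init _ hPhi hp') mxE.
    case: eqVneq => // kj; case: nij; rewrite -kj; exact: Sk.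
  - by rewrite pq'' lexx.
have := @transition_column_pos p' q' i j hp' hq' pq' ij.
by move: y0; rewrite Si /y -colE mxE => ->; rewrite mul0r ltxx.
Qed.

End Necessity.

Theorem theorem6 (R : realType) (n : nat) (hn : (0 < n)%N)
    (a b : \bar R) (hab : (a < b)%E) (A : R -> 'M[R]_n)
    (hA : {within ooset a b, continuous A}) :
  ((forall s, ooset a b s -> cyclic_tridiagonal_metzler (A s)) /\
   (forall p q : R, (a < p%:E)%E -> p < q -> (q%:E < b)%E ->
      exists tstar : R, p <= tstar <= q /\ irreducible_mx (A tstar)))
  <-> CVDDS a b A.
Proof.
split=> [[hQ hirr]|[Phi [hPhi hV]]].
  have [Phi hPhi] := transition_exists hA.
  exists Phi; split=> // t0 t h0 ht t0t.
  apply: (transition_SCVDP hA hn hQ _ hPhi h0 ht t0t) => p q [ap _] [_ qb] pq.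
  by have [t1 [h1 h2]] := hirr p q ap pq qb; exists t1.
split=> [s Is|p q ap pq qb].
  split; first exact: (necessary_metzler hPhi hV Is).
  move=> i j Aij; have [->|ij] := eqVneq i j; first by constructor 1.
  exact: neighboursP (necessary_band hPhi hV Is Aij ij).
have Ip : ooset a b p by split=> //; apply: lt_trans qb; rewrite lte_fin.
have Iq : ooset a b q by split=> //; apply: lt_trans ap _; rewrite lte_fin.
by have [t h1 h2] := necessary_irreducible hA hPhi hV Ip Iq pq; exists t.
Qed.
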